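(* \begin{equation*} \Gamma_{i}^{\left[\substack{s\\ s+1}\right]\times k} = \begin{cases} 1 & \text{if } i=0,\ k\geq 1,\\ 21\cdot 2^{3i-4} - 3\cdot 2^{2i-3} & \text{if } 1\leq i\leq s-1,\ k>i,\\ 2^{k+s-1} + 21\cdot 2^{3s-4} - 11\cdot 2^{2s-3} & \text{if } i=s,\ k>s,\\ 11\cdot 2^{k+s-1} + 21\cdot 2^{3s-1} - 53\cdot 2^{2s-1} & \text{if } i=s+1,\ k>s+1,\\ 21\cdot\left[2^{k-2s+3i-5} + 2^{3i-4} - 5\cdot 2^{4i-2s-6}\right] & \text{if } s+2\leq i\leq 2s,\ k>i,\\ 2^{2k+2s-1} - 3\cdot 2^{k+4s-2} + 2^{6s-2} & \text{if } i=2s+1,\ k>2s+1. \end{cases} \end{equation*}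
   Context: $\Gamma_{i}^{\left[\substack{s\\ s+1}\right]\times k}$ denotes the number of rank $i$ matrices over $\mathbb{F}_2$ of the form $\left[\frac{A}{B}\right]$ where $A$ is an $s\times k$ persymmetric matrix and $B$ an $(s+1)\times k$ persymmetric matrix over $\mathbb{F}_2$. *)

(* Defs.v *)
From mathcomp Require Import all_boot all_order all_algebra.
Set Implicit Arguments.
Unset Strict Implicit.
Unset Printing Implicit Defensive.
Import GRing.Theory Num.Theory.

(* "Persymmetric" for a possibly rectangular matrix means that the entries are
   constant along antidiagonals, i.e. a Hankel matrix. *)
Definition persymmetric (T : eqType) (m n : nat) (A : 'M[T]_(m, n)) : bool :=
  [forall i : 'I_m, forall j : 'I_n, forall i' : 'I_m, forall j' : 'I_n,
     (i + j == i' + j') ==> (A i j == A i' j')].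

Definition double_persym (s k : nat) : {set 'M['F_2]_(s + s.+1, k)} :=
  [set col_mx A B | A : 'M['F_2]_(s, k) in @persymmetric _ s k,
                    B : 'M['F_2]_(s.+1, k) in @persymmetric _ s.+1 k].

Definition Gamma (s k i : nat) : nat :=
  #|[set M in double_persym s k | \rank M == i]|.

(* Main.v *)
Require Import Defs.
From mathcomp Require Import all_boot all_order all_algebra.
From mathcomp Require Import mxabelem zify ring.
Import GRing.Theory Num.Theory.
Local Open Scope ring_scope.

(** Interleaving the two Hankel blocks turns the pair into a single sequence [c], and the
    matrix into [c_(t + 2m)], [t < n := 2s+1], [m < k].  Left kernel vectors are polynomials
    [w] of degree [< n], right kernel vectors are polynomials [p] of degree [< k].

    If the right kernel is not of the form [p * (polynomials of bounded degree)], comparing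
    with the shape [(n - 2, k + 1)] shows that ['X^2] maps a subspace of codimension at most
    one of the left kernel into the left kernel, so the left kernel is [w] times the polynomials in ['X^2] of bounded degree.
    Hence the number of matrices of rank [i < k] differs from the number of
    pairs (matrix, primitive left kernel vector of the appropriate degree) only through
    matrices whose right kernel is generated by one [p]; sequences annihilated by [p] are
    matched for different [k] by contraction with a polynomial coprime to [p] (also at
    infinity), which keeps the left kernel.  So this difference does not depend on [k > i],
    while the number of pairs is explicit.  Finally the count of pairs (matrix, right kernel
    vector) at [k = i + 1] gives a triangular system that fixes all values recursively. *)

Local Notation F := 'F_2.

(** * Characteristic two, and degrees after substituting a power of the variable *)

Lemma F2_neq0 (a : F) : a != 0 -> a = 1.
Proof. by case: a => [[|[|m]] hm] // _; apply: val_inj. Qed.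

Lemma F2P (a b : F) : a != 0 -> b != 0 -> a + b = 0.
Proof. by move=> /F2_neq0 -> /F2_neq0 ->; apply: val_inj. Qed.

Lemma addpp (p : {poly F}) : p + p = 0.
Proof. by apply: addrr_pchar2; rewrite pchar_poly pchar_Fp. Qed.

Lemma addp_eq0 (p q : {poly F}) : (p + q == 0) = (p == q).
Proof. by rewrite addr_eq0 (_ : - q = q) //; apply/eqP; rewrite eq_sym -addr_eq0 addpp. Qed.

Lemma addpK (p q : {poly F}) : p + q + q = p.
Proof. by rewrite -addrA addpp addr0. Qed.

Lemma size_compXn (p : {poly F}) e : (0 < e)%N -> p != 0 ->
  size (p \Po 'X^e) = ((size p).-1 * e).+1.
Proof.
move=> e0 p0; have := size_comp_poly p 'X^e; rewrite size_polyXn /= => <-.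
by rewrite prednK // lt0n size_poly_eq0 comp_poly_eq0 // size_polyXn.
Qed.

Lemma size_compXn_le (p : {poly F}) e k : (0 < e)%N -> (size p <= k)%N ->
  (size (p \Po 'X^e) <= (k.-1 * e).+1)%N.
Proof.
move=> e0 hp; have [->|p0] := eqVneq p 0; first by rewrite comp_poly0 size_poly0.
by rewrite size_compXn // ltnS leq_mul2r; apply/orP; right; lia.
Qed.

(** * Sequences as linear functionals on polynomials *)

(** The sequence [c] acts as the functional sending ['X^j] to its [j]-th term, so that kernel
    conditions become orthogonality to products of polynomials. *)
Definition pairing (c g : {poly F}) : F := \sum_(j < size g) c`_j * g`_j.

Lemma pairingE N (c g : {poly F}) : (size g <= N)%N ->
  pairing c g = \sum_(j < N) c`_j * g`_j.
Proof.
move=> h; rewrite /pairing (big_ord_widen N (fun j => c`_j * g`_j)) //.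
rewrite [RHS](bigID (fun j : 'I_N => (j < size g)%N)) /= [X in _ + X]big1 ?addr0 //.
by move=> j; rewrite -leqNgt => hj; rewrite (nth_default 0 hj) mulr0.
Qed.

Lemma pairingD (c g h : {poly F}) : pairing c (g + h) = pairing c g + pairing c h.
Proof.
set N := maxn (size g) (size h).
rewrite !(@pairingE N) ?size_polyD ?leq_maxl ?leq_maxr // -big_split /=.
by apply: eq_bigr => j _; rewrite coefD mulrDr.
Qed.

Lemma pairing0r (c : {poly F}) : pairing c 0 = 0.
Proof. by rewrite /pairing size_poly0 big_ord0. Qed.

Lemma pairingDl (c d g : {poly F}) : pairing (c + d) g = pairing c g + pairing d g.
Proof.
by rewrite /pairing -big_split; apply: eq_bigr => j _; rewrite coefD mulrDl.
Qed.

Lemma pairingZ (c g : {poly F}) a : pairing c (a *: g) = a * pairing c g.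
Proof.
rewrite (@pairingE (size g)) ?size_scale_leq // mulr_sumr.
by apply: eq_bigr => j _; rewrite coefZ mulrCA.
Qed.

Lemma pairing_sum (c : {poly F}) I (r : seq I) (P : pred I) (E : I -> {poly F}) :
  pairing c (\sum_(x <- r | P x) E x) = \sum_(x <- r | P x) pairing c (E x).
Proof. exact: (big_morph _ (pairingD c) (pairing0r c)). Qed.

Lemma pairingXn (c : {poly F}) a : pairing c 'X^a = c`_a.
Proof.
rewrite (@pairingE a.+1) ?size_polyXn // big_ord_recr big1 /= => [|j _].
  by rewrite coefXn eqxx mulr1 add0r.
by rewrite coefXn ltn_eqF ?mulr0.
Qed.

Lemma pairingXnl a (g : {poly F}) : pairing 'X^a g = g`_a.
Proof.
rewrite (@pairingE (maxn a.+1 (size g))) ?leq_maxr //.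
have ha : (a < maxn a.+1 (size g))%N by rewrite leq_max leqnn.
rewrite (bigD1 (Ordinal ha)) //= coefXn eqxx mul1r big1 ?addr0 // => j hj.
by rewrite coefXn (_ : (j == a :> nat) = false) ?mul0r //; apply/negbTE.
Qed.

Lemma pairing_comp (c : {poly F}) e a k (p : {poly F}) : (size p <= k)%N ->
  pairing c ((p \Po 'X^e) * 'X^a) = \sum_(m < k) p`_m * c`_(e * m + a).
Proof.
move=> h; rewrite comp_polyE mulr_suml pairing_sum.
rewrite (big_ord_widen k (fun m => pairing c (p`_m *: 'X^e ^+ m * 'X^a))) //.
rewrite [RHS](bigID (fun j : 'I_k => (j < size p)%N)) /= [X in _ = _ + X]big1 ?addr0.
  by apply: eq_bigr => j _; rewrite -scalerAl pairingZ -exprM -exprD pairingXn.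
by move=> j; rewrite -leqNgt => hj; rewrite (nth_default 0 hj) mul0r.
Qed.

Lemma pairing_shift (c : {poly F}) a n (w : {poly F}) : (size w <= n)%N ->
  pairing c (w * 'X^a) = \sum_(t < n) w`_t * c`_(t + a).
Proof.
move=> h; have := @pairing_comp c 1 a n w h; rewrite expr1 comp_polyXr => ->.
by apply: eq_bigr => t _; rewrite mul1n.
Qed.

(* The adjoint of multiplication by [f]. *)
Definition contract N (f c : {poly F}) : {poly F} := \poly_(j < N) pairing c (f * 'X^j).

Lemma pairing_contract N (f c g : {poly F}) : (size g <= N)%N ->
  pairing (contract N f c) g = pairing c (f * g).
Proof.
move=> h; rewrite (@pairingE N) // -{2}[g]coefK poly_def mulr_sumr pairing_sum.
rewrite (big_ord_widen N (fun m => pairing c (f * (g`_m *: 'X^m)))) //.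
rewrite [LHS](bigID (fun j : 'I_N => (j < size g)%N)) /= [X in _ + X = _]big1 ?addr0.
  by apply: eq_bigr => j _; rewrite coef_poly ltn_ord -scalerAr pairingZ mulrC.
by move=> j; rewrite -leqNgt => hj; rewrite (nth_default 0 hj) mulr0.
Qed.

(** * Counting polynomials and annihilated sequences *)

Definition cnt n (P : pred {poly F}) := #|[set v : 'rV[F]_n | P (rVpoly v)]|.

Lemma size_rVpoly n (v : 'rV[F]_n) : (size (rVpoly v) <= n)%N.
Proof. exact: size_poly. Qed.

Lemma rVpoly_inj n : injective (@rVpoly F n).
Proof. exact: can_inj rVpolyK. Qed.

Lemma card_rV n : #|{: 'rV[F]_n}| = (2 ^ n)%N.
Proof. by rewrite card_mx card_Fp // mul1n. Qed.

(* Flipping [c] at the leading position of the last [g j] leaves the other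
   pairings unchanged, so each condition halves the set. *)
Lemma card_annihilator N m (g : nat -> {poly F}) :
    (forall j, (j < m)%N -> (0 < size (g j) <= N)%N) ->
    (forall j l, (j < l < m)%N -> (size (g j) < size (g l))%N) ->
  (cnt N (fun c => [forall j : 'I_m, pairing c (g j) == 0%R]) * 2 ^ m = 2 ^ N)%N.
Proof.
rewrite /cnt; elim: m => [|m IH] hs hlt.
  rewrite muln1 -card_rV -cardsT; apply: eq_card => v; rewrite !inE.
  by apply/forallP => -[].
rewrite expnS mulnA -IH; last 2 first.
- by move=> j hj; apply: hs; apply: ltnW.
- by move=> j l /andP[h1 h2]; apply: hlt; rewrite h1 ltnW.
congr (_ * _)%N; set A := [set _ | _]; set B := [set _ | _].
have /andP[g0 gN] := hs m (ltnSn m).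
have hN : ((size (g m)).-1 < N)%N by rewrite prednK.
pose d : 'rV[F]_N := delta_mx 0 (Ordinal hN).
have rd (v : 'rV[F]_N) : rVpoly (v + d) = rVpoly v + 'X^((size (g m)).-1).
  by rewrite linearD /= rVpoly_delta.
have low (v : 'rV[F]_N) j : (j < m)%N -> pairing (rVpoly (v + d)) (g j) = pairing (rVpoly v) (g j).
  move=> hj; rewrite rd pairingDl pairingXnl nth_default ?addr0 //.
  have : (size (g j) < size (g m))%N by rewrite hlt // hj /=.
  by case: (size (g m)).
have top (v : 'rV[F]_N) : pairing (rVpoly (v + d)) (g m) = pairing (rVpoly v) (g m) + 1.
  rewrite rd pairingDl pairingXnl -/(lead_coef (g m)) (F2_neq0 (lead_coef (g m))) //.
  by rewrite lead_coef_eq0 -size_poly_gt0.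
have BA : B = A :|: (fun v => v + d) @: A.
  have dd (v : 'rV[F]_N) : v + d + d = v.
    apply: rVpoly_inj; rewrite !rd; exact: addpK.
  have inA v : (v \in A) = (v \in B) && (pairing (rVpoly v) (g m) == 0).
    rewrite !inE; apply/forallP/andP => [h|[/forallP h1 h2] j].
      split; last exact: (h ord_max).
      by apply/forallP => j; apply: (h (widen_ord (leqnSn m) j)).
    have [jm|jm] := ltnP j m; first exact: (h1 (Ordinal jm)).
    by have -> : nat_of_ord j = m by apply/eqP; rewrite eqn_leq jm -ltnS ltn_ord.
  have inB (v : 'rV[F]_N) : (v + d \in B) = (v \in B).
    by rewrite !inE; apply: eq_forallb => j; rewrite low.
  apply/setP => v; rewrite in_setU inA.
  have [vB|vB] := boolP (v \in B) => /=; last first.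
    apply/esym/imsetP => -[u]; rewrite inA => /andP[uB _] vu.
    by rewrite vu inB uB in vB.
  have [//|hv] := boolP (pairing (rVpoly v) (g m) == 0); apply/esym/imsetP.
  exists (v + d); last by rewrite dd.
  by rewrite inA inB vB top F2P.
rewrite BA cardsU (_ : _ :&: _ = set0) ?cards0 ?subn0.
  by rewrite card_imset ?addnn ?muln2 //; apply: addIr.
apply/setP => v; rewrite in_setI in_set0; apply/negP => /andP[vA /imsetP[u uA vu]].
move: vA uA; rewrite !inE vu => /forallP/(_ ord_max) /=.
by rewrite top => h /forallP/(_ ord_max) /= /eqP h2; rewrite h2 in h.
Qed.

(** * Left and right kernels as spaces of polynomials *)

Definition hank n k (c : {poly F}) : 'M[F]_(n, k) := \matrix_(t, m) c`_(t + 2 * m).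

Definition inL n k (c w : {poly F}) : bool :=
  (size w <= n)%N && [forall m : 'I_k, pairing c (w * 'X^(2 * m)) == 0].

(** Adjacent columns are two indices apart and adjacent rows one, so a right kernel vector enters
    through [p \Po 'X^2] and the row index as a power of ['X]. *)
Definition inK n k (c p : {poly F}) : bool :=
  (size p <= k)%N && [forall t : 'I_n, pairing c ((p \Po 'X^2) * 'X^t) == 0].

Lemma card_left_kernel m n (A : 'M[F]_(m, n)) :
  #|[set u : 'rV_m | u *m A == 0]| = (2 ^ (m - \rank A))%N.
Proof.
have := card_rowg (kermx A); rewrite card_Fp // mxrank_ker => <-.
by apply: eq_card => u; rewrite mem_rowg inE; apply/eqP/sub_kermxP.
Qed.

Lemma cnt_inL n k c : cnt n (inL n k c) = (2 ^ (n - \rank (hank n k c)))%N.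
Proof.
rewrite -card_left_kernel; apply: eq_card => v; rewrite !inE /inL size_rVpoly /=.
(* Column [m] does not depend on the number of columns, so it is read as the last column of
   [hank n m.+1 c]. *)
have E m : pairing c (rVpoly v * 'X^(2 * m)) = (v *m hank n m.+1 c) 0 ord_max.
  rewrite (@pairing_shift _ _ n) ?size_rVpoly // mxE; apply: eq_bigr => t _.
  by rewrite mxE coef_rVpoly_ord.
apply/forallP/eqP => [h|h m]; last first.
  have := congr1 (fun M : 'rV_k => M 0 m) h; rewrite E !mxE => hm.
  by apply/eqP; rewrite -[RHS]hm; apply: eq_bigr => t _; rewrite !mxE.
apply/rowP => m; rewrite [RHS]mxE -(eqP (h m)) E !mxE.
by apply: eq_bigr => t _; rewrite !mxE.
Qed.

Lemma cnt_inK n k c : cnt k (inK n k c) = (2 ^ (k - \rank (hank n k c)))%N.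
Proof.
rewrite -mxrank_tr -card_left_kernel; apply: eq_card => v.
rewrite !inE /inK size_rVpoly /=.
have E t : pairing c ((rVpoly v \Po 'X^2) * 'X^t) = (v *m (hank t.+1 k c)^T) 0 ord_max.
  rewrite (@pairing_comp _ _ _ k) ?size_rVpoly // mxE; apply: eq_bigr => m _.
  by rewrite !mxE coef_rVpoly_ord addnC.
apply/forallP/eqP => [h|h m]; last first.
  have := congr1 (fun M : 'rV_n => M 0 m) h; rewrite E !mxE => hm.
  by apply/eqP; rewrite -[RHS]hm; apply: eq_bigr => t _; rewrite !mxE.
apply/rowP => m; rewrite [RHS]mxE -(eqP (h m)) E !mxE.
by apply: eq_bigr => t _; rewrite !mxE.
Qed.

Lemma inLP n k (c w : {poly F}) :
  reflect ((size w <= n)%N /\ forall m, (m < k)%N -> pairing c (w * 'X^(2 * m)) = 0)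
          (inL n k c w).
Proof.
apply: (iffP andP) => -[h1].
  by move/forallP=> h2; split=> // m hm; apply/eqP/(h2 (Ordinal hm)).
by move=> h2; split=> //; apply/forallP => m; rewrite h2.
Qed.

Lemma inKP n k (c p : {poly F}) :
  reflect ((size p <= k)%N /\ forall t, (t < n)%N -> pairing c ((p \Po 'X^2) * 'X^t) = 0)
          (inK n k c p).
Proof.
apply: (iffP andP) => -[h1].
  by move/forallP=> h2; split=> // m hm; apply/eqP/(h2 (Ordinal hm)).
by move=> h2; split=> //; apply/forallP => m; rewrite h2.
Qed.

Lemma inL0 n k c : inL n k c 0.
Proof. by apply/inLP; rewrite size_poly0; split=> // m _; rewrite mul0r pairing0r. Qed.

Lemma inK0 n k c : inK n k c 0.
Proof.
by apply/inKP; rewrite size_poly0; split=> // m _; rewrite comp_poly0 mul0r pairing0r.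
Qed.

Lemma inLD n k c x y : inL n k c x -> inL n k c y -> inL n k c (x + y).
Proof.
move=> /inLP[sx hx] /inLP[sy hy]; apply/inLP; split.
  by rewrite (leq_trans (size_polyD _ _)) // geq_max sx.
by move=> m hm; rewrite mulrDl pairingD hx ?hy ?addr0.
Qed.

Lemma inKD n k c x y : inK n k c x -> inK n k c y -> inK n k c (x + y).
Proof.
move=> /inKP[sx hx] /inKP[sy hy]; apply/inKP; split.
  by rewrite (leq_trans (size_polyD _ _)) // geq_max sx.
by move=> m hm; rewrite linearD mulrDl pairingD hx ?hy ?addr0.
Qed.

(** * Shifted kernel vectors and cyclic subgroups *)

Lemma size_mulXn_le (w : {poly F}) a n :
  (size (w * 'X^a)%R <= n)%N = (w == 0) || (size w + a <= n)%N.
Proof.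
have [->|w0] /= := eqVneq w 0; first by rewrite mul0r size_poly0.
by rewrite size_mulXn // addnC.
Qed.

(** Two rows are traded for one column: a column index below [k + j] splits into a shift [a <= j] of
    [w] and a column index below [k]. *)
Lemma inL_tower n k j (c w : {poly F}) : (0 < k)%N ->
  reflect (forall a, (a <= j)%N -> inL n k c (w * 'X^(2 * a)))
          (inL (n - 2 * j) (k + j) c w).
Proof.
move=> k0; have [->|w0] := eqVneq w 0.
  by rewrite inL0; left=> a _; rewrite mul0r inL0.
have sw : (0 < size w)%N by rewrite lt0n size_poly_eq0.
apply: (iffP idP) => [/inLP[s h] a ha|h].
  apply/inLP; split; first by rewrite size_mulXn_le; apply/orP; right; lia.
  by move=> m hm; rewrite -mulrA -exprD -mulnDr h //; lia.
apply/inLP; split.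
  by have /inLP[] := h j (leqnn j); rewrite size_mulXn_le (negbTE w0) /=; lia.
move=> m hm; pose a := minn m j.
have ha : (a <= j)%N by rewrite geq_minr.
have km : (m - a < k)%N by rewrite /a; lia.
have /inLP[_ H] := h a ha; have := H (m - a)%N km.
by rewrite -mulrA -exprD -mulnDr subnKC ?geq_minl.
Qed.

(* The last hypothesis passes from [P] to the set of [x] in [P] with [x * 'X^e] in [P],
   whose elements have smaller size. *)
Lemma cyclic_subgroup e b (P : pred {poly F}) :
    (0 < e)%N -> P 0 -> (forall x y, P x -> P y -> P (x + y)) ->
    (forall x, P x -> (size x <= b)%N) ->
    (forall x y, P x -> P y -> ~~ P (x * 'X^e) -> ~~ P (y * 'X^e) ->
       P ((x + y) * 'X^e)) ->
  exists (w : {poly F}) d, w != 0 /\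
    forall g, P g <-> exists2 r : {poly F}, (size r <= d)%N & g = (r \Po 'X^e) * w.
Proof.
move=> e0; elim: b P => [|b IH] P P0 PD Pb Pi.
  exists 1, 0%N; split; first exact: oner_neq0.
  move=> g; split=> [/Pb|[r]]; rewrite leqn0 size_poly_eq0 => /eqP ->.
    by exists 0; rewrite ?size_poly0 // comp_poly0 mul0r.
  by rewrite comp_poly0 mul0r => ->.
pose Q g := P g && P (g * 'X^e).
have [] := IH Q.
- by rewrite /Q mul0r P0.
- by move=> x y /andP[x1 x2] /andP[y1 y2]; rewrite /Q mulrDl !PD.
- move=> x /andP[_ /Pb]; rewrite size_mulXn_le => /orP[/eqP->|]; rewrite ?size_poly0 //; lia.
- move=> x y /andP[x1 x2] /andP[y1 y2]; rewrite /Q !mulrDl => hx hy.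
  have /= := Pi _ _ x2 y2; rewrite x2 y2 /= in hx hy.
  by rewrite PD // mulrDl => ->.
move=> w [d [w0 hQ]].
(* If [Q] is trivial, the last hypothesis forces any two nonzero elements of [P] to be equal. *)
have [d0|d0] := posnP d.
  have Q1 x : Q x -> x = 0.
    move/hQ => [r]; rewrite d0 leqn0 size_poly_eq0 => /eqP -> ->.
    by rewrite comp_poly0 mul0r.
  have nz x : P x -> x != 0 -> ~~ P (x * 'X^e).
    by move=> Px; apply: contra => Px'; apply/eqP/Q1; rewrite /Q Px.
  have eqnz x y : P x -> P y -> x != 0 -> y != 0 -> x = y.
    move=> Px Py x0 y0; apply/eqP; rewrite -addp_eq0; apply/eqP/Q1.
    by rewrite /Q PD // Pi ?nz.
  case: (pickP (fun v : 'rV[F]_b.+1 => P (rVpoly v) && (rVpoly v != 0))) => [v /andP[Pv v0]|h].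
    exists (rVpoly v), 1%N; split=> // g; split=> [Pg|[r]].
      have [->|g0] := eqVneq g 0.
        by exists 0; rewrite ?size_poly0 // comp_poly0 mul0r.
      by exists 1; rewrite ?size_poly1 // comp_polyC mul1r; apply: eqnz.
    move/size1_polyC => ->; rewrite comp_polyC => ->.
    by have [->|/F2_neq0->] := eqVneq r`_0 0; rewrite ?mul0r ?mul1r.
  exists 1, 0%N; split=> [|g]; first exact: oner_neq0.
  split=> [Pg|[r]]; last first.
    by rewrite leqn0 size_poly_eq0 => /eqP -> ->; rewrite comp_poly0 mul0r.
  exists 0; rewrite ?size_poly0 // comp_poly0 mul0r; apply/eqP.
  have := h (poly_rV g); rewrite poly_rV_K ?Pb // Pg /=.
  by move/negbT; rewrite negbK.
have EX a : ('X^a \Po 'X^e) * w = w * 'X^(a * e) :> {poly F}.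
  by rewrite comp_Xn_poly -exprM mulnC mulrC.
(* The generator of [Q] also generates [P]: its first multiple outside [Q], namely [w * 'X^(d * e)],
   lies in [P], and every element of [P] outside [Q] differs from it by an element of [Q]. *)
have Qtop : Q (w * 'X^(d.-1 * e)).
  by apply/hQ; exists ('X^(d.-1)); rewrite ?size_polyXn ?prednK // EX.
have Ptop : P (w * 'X^(d * e)).
  case/andP: Qtop => _; rewrite -mulrA -exprD -{2}[e]mul1n -mulnDl addn1 prednK //.
have nQtop : ~~ Q (w * 'X^(d * e)).
  apply/negP => /hQ[r sr]; rewrite -EX => /(mulIf w0) /eqP.
  rewrite -addp_eq0 -linearD comp_poly_eq0 ?size_polyXn //.
  rewrite addp_eq0 => /eqP E; by rewrite -E size_polyXn ltnn in sr.
exists w, d.+1; split=> // g; split=> [Pg|[r sr ->]].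
  have [/hQ[r sr ->]|nQg] := boolP (Q g); first by exists r => //; apply: leqW.
  have : Q (g + w * 'X^(d * e)).
    rewrite /Q PD //= Pi //; first by apply: contra nQg => ?; rewrite /Q Pg.
    by apply: contra nQtop => ?; rewrite /Q Ptop.
  move/hQ => [r sr E]; exists (r + 'X^d).
    rewrite (leq_trans (size_polyD _ _)) // geq_max size_polyXn leqnn andbT.
    exact: leqW.
  by rewrite linearD mulrDl EX -E addpK.
have lo (q : {poly F}) : (size q <= d)%N -> P ((q \Po 'X^e) * w).
  by move=> sq; have /andP[] : Q ((q \Po 'X^e) * w) by apply/hQ; exists q.
have [rd|rd] := eqVneq r`_d 0.
  apply: lo; apply/leq_sizeP => j; rewrite leq_eqVlt => /orP[/eqP <- //|hj].
  by rewrite nth_default // (leq_trans sr).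
rewrite -[r](addpK _ 'X^d) linearD mulrDl EX; apply: PD => //; apply: lo.
apply/leq_sizeP => j; rewrite coefD coefXn leq_eqVlt => /orP[/eqP <-|hj].
  by rewrite eqxx F2P.
by rewrite gtn_eqF // addr0 nth_default // (leq_trans sr).
Qed.

Lemma cnt_cyclic e n d (w : {poly F}) (P : pred {poly F}) :
    (0 < e)%N -> w != 0 -> (forall x, P x -> (size x <= n)%N) ->
    (forall g, P g <-> exists2 r : {poly F}, (size r <= d)%N & g = (r \Po 'X^e) * w) ->
  cnt n P = (2 ^ d)%N.
Proof.
move=> e0 w0 Pn hP; pose f (u : 'rV[F]_d) : 'rV[F]_n := poly_rV ((rVpoly u \Po 'X^e) * w).
have Pf (u : 'rV[F]_d) : P ((rVpoly u \Po 'X^e) * w).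
  by apply/hP; exists (rVpoly u); rewrite ?size_rVpoly.
have fE u : rVpoly (f u) = (rVpoly u \Po 'X^e) * w by rewrite poly_rV_K // Pn.
have finj : injective f.
  move=> u v /(congr1 (@rVpoly F n)); rewrite !fE => /(mulIf w0)/eqP.
  rewrite -addp_eq0 -linearD comp_poly_eq0 ?size_polyXn // addp_eq0 => /eqP.
  exact: rVpoly_inj.
rewrite -(card_rV d) -(card_imset _ finj); apply: eq_card => v; rewrite inE.
apply/idP/imsetP => [/hP[r sr E]|[u _ ->]]; last by rewrite fE.
by exists (poly_rV r) => //; apply: rVpoly_inj; rewrite fE poly_rV_K.
Qed.

Lemma cnt_widen n m (P : pred {poly F}) :
  (n <= m)%N -> (forall x, P x -> (size x <= n)%N) -> cnt m P = cnt n P.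
Proof.
move=> nm Pn; pose f (u : 'rV[F]_n) : 'rV[F]_m := poly_rV (rVpoly u).
have fE u : rVpoly (f u) = rVpoly u.
  by rewrite poly_rV_K // (leq_trans (size_rVpoly _ _)).
have finj : injective f.
  by move=> u v /(congr1 (@rVpoly F m)); rewrite !fE; apply: rVpoly_inj.
rewrite {2}/cnt -(card_imset _ finj); apply: eq_card => v; rewrite inE.
apply/idP/imsetP => [h|[u]]; last by rewrite inE => h ->; rewrite fE.
exists (poly_rV (rVpoly v)); first by rewrite inE poly_rV_K ?Pn.
by apply: rVpoly_inj; rewrite fE poly_rV_K ?Pn.
Qed.

Lemma cnt_eq n (P Q : pred {poly F}) : P =1 Q -> cnt n P = cnt n Q.
Proof. by move=> PQ; apply: eq_card => v; rewrite !inE PQ. Qed.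

(** * The dichotomy: one of the two kernels is cyclic *)

(** Were [x + y] outside [Q], then [Q], its translate by [x] and the point [y] would be disjoint
    parts of [P], with more than [2 * cnt n Q] elements together. *)
Lemma index_two n (P Q : pred {poly F}) x y :
    (forall g h, P g -> P h -> P (g + h)) -> (forall g, P g -> (size g <= n)%N) ->
    (forall g, Q g -> P g) -> (cnt n P <= 2 * cnt n Q)%N ->
    (forall g h, Q g -> Q h -> Q (g + h)) ->
  P x -> P y -> ~~ Q x -> ~~ Q y -> Q (x + y).
Proof.
move=> PD Pn QP le QD Px Py nQx nQy; apply: contraLR le => nQxy; rewrite -ltnNge.
pose S := [set v : 'rV[F]_n | Q (rVpoly v)].
pose xr : 'rV[F]_n := poly_rV x; pose yr : 'rV[F]_n := poly_rV y.
pose T := [set v + xr | v in S].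
have xE : rVpoly xr = x by rewrite poly_rV_K ?Pn.
have yE : rVpoly yr = y by rewrite poly_rV_K ?Pn.
have cT : #|T| = #|S| by rewrite card_imset //; apply: addIr.
have dis : [disjoint S & T].
  rewrite disjoint_sym disjoints_subset; apply/subsetP => _ /imsetP[v vS ->].
  rewrite !inE in vS *; apply: contra nQx; rewrite linearD /= xE => vx.
  by rewrite -[x](addpK _ (rVpoly v)) QD // addrC.
have yn : yr \notin S :|: T.
  rewrite !inE yE (negbTE nQy) /=; apply/imsetP => -[v vS /(congr1 (@rVpoly F n))].
  rewrite linearD /= xE yE => E; move: nQxy; rewrite E addrC addpK.
  by rewrite inE in vS; rewrite vS.
have : (#|yr |: (S :|: T)| <= cnt n P)%N.
  apply/subset_leq_card/subsetP => v; rewrite !inE => /orP[/eqP->|/orP[|]].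
  - by rewrite yE.
  - exact: QP.
  case/imsetP => u uS ->; rewrite linearD /= xE PD //; apply: QP.
  by rewrite inE in uS.
by rewrite cardsU1 yn cardsU (disjoint_setI0 dis) cards0 subn0 cT addnn -mul2n.
Qed.

Lemma inK_up n k c x : (1 < n)%N -> inK n k c x -> inK (n - 2) k.+1 c x.
Proof.
move=> n1 /inKP[s h]; apply/inKP; split; first exact: leqW.
by move=> t ht; apply: h; lia.
Qed.

Lemma comp_mulX2 (x : {poly F}) a : (x * 'X^a) \Po 'X^2 = (x \Po 'X^2) * 'X^(2 * a).
Proof. by rewrite comp_polyM comp_Xn_poly exprM. Qed.

Lemma inK_upX n k c x : (1 < n)%N -> inK n k c x -> inK (n - 2) k.+1 c (x * 'X).
Proof.
move=> n1 /inKP[s h]; apply/inKP; split.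
  by rewrite -['X]expr1 size_mulXn_le; apply/orP; right; lia.
by move=> t ht; rewrite -['X]expr1 comp_mulX2 -mulrA -exprD h //; lia.
Qed.

(** The kernel and ['X] times the span of [x] and [y] both lie in the kernel of shape
    [(n - 2, k + 1)]. The three negated hypotheses make the shifted span meet the original kernel
    only in 0, so all sums are distinct. *)
Lemma cnt_inK_up n k c x y : (1 < n)%N -> inK n k c x -> inK n k c y ->
    ~~ inK n k c (x * 'X) -> ~~ inK n k c (y * 'X) -> ~~ inK n k c ((x + y) * 'X) ->
  (4 * cnt k (inK n k c) <= cnt k.+1 (inK (n - 2) k.+1 c))%N.
Proof.
move=> n1 Kx Ky nx ny nxy.
pose z (a : F * F) := a.1 *: x + a.2 *: y.
pose f (a : (F * F) * 'rV[F]_k) : 'rV[F]_k.+1 := poly_rV (rVpoly a.2 + z a.1 * 'X).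
pose A := setX [set: F * F] [set v : 'rV[F]_k | inK n k c (rVpoly v)].
have cA : #|A| = (4 * cnt k (inK n k c))%N.
  by rewrite cardsX cardsT card_prod card_Fp.
have F2c (a : F) : a = 0 \/ a = 1.
  by have [->|/F2_neq0] := eqVneq a 0; [left | right].
have zE a : [\/ a.1 = 0 /\ a.2 = 0, z a = x, z a = y | z a = x + y].
  rewrite /z; have [->|->] := F2c a.1; have [->|->] := F2c a.2;
  rewrite ?(scale0r, scale1r, addr0, add0r); [exact: Or41|exact: Or43|exact: Or42|exact: Or44].
have Kz a : inK n k c (z a).
  case: (zE a) => [[z1 z2]|->|->|->]; [|exact: Kx|exact: Ky|exact: inKD].
  by rewrite /z z1 z2 !scale0r addr0 inK0.
have fK a : a \in A -> rVpoly (f a) = rVpoly a.2 + z a.1 * 'X /\ inK (n - 2) k.+1 c (rVpoly (f a)).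
  rewrite !inE /= => Ka.
  have H : inK (n - 2) k.+1 c (rVpoly a.2 + z a.1 * 'X).
    exact: inKD (inK_up _ _ _ _ n1 Ka) (inK_upX _ _ _ _ n1 (Kz a.1)).
  have E : rVpoly (f a) = rVpoly a.2 + z a.1 * 'X.
    by rewrite poly_rV_K //; case/inKP: H.
  by rewrite E.
have finj : {in A &, injective f}.
  move=> [a u] [b v] hA hB /(congr1 (@rVpoly F k.+1)).
  have [-> _] := fK _ hA; have [-> _] := fK _ hB; rewrite /= => E.
  have E2 : z (a.1 + b.1, a.2 + b.2) * 'X = rVpoly u + rVpoly v.
    have -> : z (a.1 + b.1, a.2 + b.2) = z a + z b.
      by rewrite /z /= !scalerDl addrACA.
    apply/eqP; rewrite -addp_eq0.
    by rewrite mulrDl addrACA [z a * _ + _]addrC [z b * _ + _]addrC E addpp.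
  have Kuv : inK n k c (rVpoly u + rVpoly v).
    move: hA hB; rewrite !inE /= => Ku Kv; exact: inKD Ku Kv.
  move: Kuv; rewrite -E2; have [[]|->|->|->] := zE (a.1 + b.1, a.2 + b.2).
  - move=> a0 b0 _; move: E2; rewrite /z a0 b0 !scale0r addr0 mul0r => /esym/eqP.
    have ab (s t : F) : s + t = 0 -> s = t.
      by have [->|->] := F2c s; have [->|->] := F2c t => // /eqP; rewrite oner_eq0.
    rewrite addp_eq0 => /eqP/rVpoly_inj ->.
    by case: a b a0 b0 {E hA hB} => [a1 a2] [b1 b2] /= /ab -> /ab ->.
  - by rewrite (negbTE nx).
  - by rewrite (negbTE ny).
  - by rewrite (negbTE nxy).
rewrite -cA -(card_in_imset finj); apply/subset_leq_card/subsetP => _ /imsetP[a aA ->].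
by rewrite inE; case: (fK _ aA).
Qed.

Definition cyclic e d w (P : pred {poly F}) : Prop :=
  w != 0 /\ forall g, P g <-> exists2 r : {poly F}, (size r <= d)%N & g = (r \Po 'X^e) * w.

Lemma inL_size n k c w : inL n k c w -> (size w <= n)%N.
Proof. by case/inLP. Qed.

Lemma inK_size n k c w : inK n k c w -> (size w <= k)%N.
Proof. by case/inKP. Qed.

Lemma cyclic_inK_or_inL n k c : (1 < n)%N -> (0 < k)%N ->
  (exists w d, cyclic 1 d w (inK n k c)) \/ (exists w d, cyclic 2 d w (inL n k c)).
Proof.
move=> n1 k0.
have [h|/existsPn h] := boolP [exists x : 'rV[F]_k, exists y : 'rV[F]_k,
    [&& inK n k c (rVpoly x), inK n k c (rVpoly y), ~~ inK n k c (rVpoly x * 'X),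
        ~~ inK n k c (rVpoly y * 'X) & ~~ inK n k c ((rVpoly x + rVpoly y) * 'X)]]; last first.
  left; apply: (@cyclic_subgroup 1 k _ isT (inK0 n k c) (inKD n k c) (inK_size n k c)).
  rewrite expr1 => x y Kx Ky nx ny; apply/negPn/negP => nxy.
  have /existsPn/(_ (poly_rV y)) := h (poly_rV x).
  have [sx sy] := (inK_size _ _ _ _ Kx, inK_size _ _ _ _ Ky).
  rewrite !(poly_rV_K sx) !(poly_rV_K sy) => /negP; apply; apply/and5P; split.
  - exact: Kx.
  - exact: Ky.
  - exact: nx.
  - exact: ny.
  - exact: nxy.
right; case/existsP: h => xr /existsP[yr /and5P[Kx Ky nx ny nxy]].
(* Passing to shape [(n - 2, k + 1)] enlarges the right kernel by at least two dimensions. Hence the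
   rank drops by at least one, and the left kernel loses at most one dimension. *)
have := cnt_inK_up _ _ _ _ _ n1 Kx Ky nx ny nxy; rewrite !cnt_inK -(expnD 2 2) leq_exp2l // => hr.
have r1 := rank_leq_row (hank (n - 2) k.+1 c); have r2 := rank_leq_col (hank (n - 2) k.+1 c).
have r3 := rank_leq_row (hank n k c); have r4 := rank_leq_col (hank n k c).
pose Q w := inL n k c w && inL n k c (w * 'X^2).
have QE : Q =1 inL (n - 2) k.+1 c.
  move=> w; have := inL_tower n k 1 c w k0; rewrite muln1 addn1 => T.
  apply/andP/T => [[h0 h1] [|[|a]] //|h].
    by rewrite muln0 expr0 mulr1.
  by have := h 0%N isT; have := h 1%N isT; rewrite muln0 expr0 mulr1.
apply: (@cyclic_subgroup 2 n _ isT (inL0 n k c) (inLD n k c) (inL_size n k c)).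
move=> x y Lx Ly hx hy.
suff /andP[] : Q (x + y) by [].
apply: (@index_two n (inL n k c)) => //.
- by move=> *; apply: inLD.
- by move=> g; apply: inL_size.
- by move=> g /andP[].
- rewrite (cnt_eq _ _ _ QE) (@cnt_widen (n - 2) n (inL (n - 2) k.+1 c)) ?leq_subr //;
    last by move=> g; apply: inL_size.
  by rewrite !cnt_inL -expnS leq_exp2l //; lia.
- by move=> g h /andP[g1 g2] /andP[h1 h2]; rewrite /Q mulrDl !inLD.
- by rewrite /Q Lx.
- by rewrite /Q Ly.
Qed.

(** * Primitive left kernel vectors and the defect *)

(** For [0 < k], [inL_tower] shows that this counts the [w] whose shifts [w * 'X^(2 * a)], [a <= j],
    all stay in the left kernel of shape [(n, k)]. *)
Definition lcnt n k j c := cnt (n - 2 * j) (inL (n - 2 * j) (k + j) c).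

Lemma compXn_inj e : (0 < e)%N -> injective (fun r : {poly F} => r \Po 'X^e).
Proof.
move=> e0 u v /eqP; rewrite -addp_eq0 -linearD comp_poly_eq0 ?size_polyXn //.
by rewrite addp_eq0 => /eqP.
Qed.

Lemma lcnt_cyclic n k j c w d : (0 < k)%N -> cyclic 2 d w (inL n k c) ->
  lcnt n k j c = (2 ^ (d - j))%N.
Proof.
move=> k0 [w0 hL].
have EX (r : {poly F}) a : (r \Po 'X^2) * w * 'X^(2 * a) = ((r * 'X^a) \Po 'X^2) * w.
  by rewrite comp_mulX2 mulrAC.
apply: (@cnt_cyclic 2 _ _ w) => // [g|g]; first exact: inL_size.
split=> [/(inL_tower _ _ _ _ _ k0) h|[r sr ->]].
  have := h 0%N isT; rewrite muln0 expr0 mulr1 => /hL[r sr E].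
  exists r => //; have := h j (leqnn j); rewrite E EX => /hL[r' sr'].
  move/(mulIf w0)/(compXn_inj 2 isT) => E'; move: sr'; rewrite -E' size_mulXn_le.
  by case/orP => [/eqP->|]; rewrite ?size_poly0 //; lia.
apply/(inL_tower _ _ _ _ _ k0) => a aj; rewrite EX; apply/hL; exists (r * 'X^a) => //.
rewrite size_mulXn_le; have [//|r0] := eqVneq r 0.
have : (0 < size r)%N by rewrite size_poly_gt0.
by move: sr aj => /=; lia.
Qed.

(** A nonzero [w] counted here would span [j + 1] independent left kernel vectors with its shifts,
    exceeding the nullity. *)
Lemma lcnt_small n k j c : (0 < k)%N -> (n - \rank (hank n k c) <= j)%N -> lcnt n k j c = 1%N.
Proof.
move=> k0 hj.
have L0 w : inL (n - 2 * j) (k + j) c w -> w = 0.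
  move/(inL_tower _ _ _ _ _ k0) => h; apply/eqP/negPn/negP => w0.
  pose f (u : 'rV[F]_j.+1) := (rVpoly u \Po 'X^2) * w.
  have Lf u : inL n k c (f u).
    rewrite /f -[rVpoly u]coefK poly_def linear_sum mulr_suml /=.
    apply: (big_ind (inL n k c)) => [|x y|a _]; first exact: inL0.
      exact: inLD.
    rewrite linearZ /= comp_Xn_poly -exprM -scalerAl mulrC.
    have [->|/F2_neq0->] := eqVneq (rVpoly u)`_a 0; first by rewrite scale0r inL0.
    by rewrite scale1r h // -ltnS (leq_trans (ltn_ord a)) // size_rVpoly.
  have finj : injective (fun u => poly_rV (f u) : 'rV[F]_n).
    move=> u v /(congr1 (@rVpoly F n)); rewrite !poly_rV_K; try exact: inL_size (Lf _).
    by move/(mulIf w0)/(compXn_inj 2 isT)/rVpoly_inj.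
  have : (2 ^ j.+1 <= cnt n (inL n k c))%N.
    rewrite -(card_rV j.+1) -(card_imset _ finj); apply/subset_leq_card/subsetP.
    by move=> _ /imsetP[u _ ->]; rewrite inE poly_rV_K ?Lf //; apply: inL_size (Lf _).
  by rewrite cnt_inL leq_exp2l //; lia.
apply/eqP/cards1P; exists 0; apply/setP => v; rewrite !inE.
apply/idP/eqP => [/L0 v0|->]; last by rewrite linear0 inL0.
by apply: rVpoly_inj; rewrite v0 linear0.
Qed.

(* Counts the primitive elements [w] of the left kernel whose multiples [r('X^2) w],
   [size r <= e.+1], form a maximal segment: Moebius inversion on the projective line. *)
Definition prim n k e c : int :=
  (lcnt n k e c)%:Z - 3 * (lcnt n k e.+1 c)%:Z + 2 * (lcnt n k e.+2 c)%:Z.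

(** A cyclic left kernel at rank [i] has dimension [n - i], and its generator is its only primitive
    vector at level [n - i.+1]; the defect measures the deviation from this. *)
Definition defect n k i c : int :=
  prim n k (n - i.+1) c - (\rank (hank n k c) == i)%:Z.

Lemma defect_large n k i c : (0 < k)%N -> (i < n)%N -> (i < \rank (hank n k c))%N ->
  defect n k i c = 0.
Proof.
move=> k0 hn hr; rewrite /defect gtn_eqF //= /prim !lcnt_small //; lia.
Qed.

(** The values [2 ^ (d - j)] either stay at 1 or halve at each step, and the weights 1, -3, 2 kill
    both patterns. Only at [d = n - i], that is at rank [i], do they give [2 - 3 + 2 = 1]. *)
Lemma defect_cyclic n k i c w d : (0 < k)%N -> (i < n)%N ->
  cyclic 2 d w (inL n k c) -> defect n k i c = 0.
Proof.
move=> k0 hn hL; have r3 := rank_leq_row (hank n k c).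
have hd : d = (n - \rank (hank n k c))%N.
  have [w0 hP] := hL; have := @cnt_cyclic 2 n d w _ isT w0 (inL_size n k c) hP.
  by rewrite cnt_inL => /eqP; rewrite eqn_exp2l // => /eqP.
rewrite /defect /prim !(lcnt_cyclic _ _ _ _ _ _ k0 hL).
have [ri|ne] := eqVneq (\rank (hank n k c)) i.
  rewrite ri in hd; rewrite hd.
  rewrite (_ : n - i - _ = 1)%N; last lia.
  rewrite (_ : n - i - _.+1 = 0)%N; last lia.
  by rewrite (_ : n - i - _.+2 = 0)%N; last lia.
rewrite subr0; have [hlt|hge] := leqP d (n - i.+1).
  rewrite (_ : d - _ = 0)%N; last lia.
  rewrite (_ : d - _.+1 = 0)%N; last lia.
  by rewrite (_ : d - _.+2 = 0)%N; last lia.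
have [m ->] : exists m, d = ((n - i.+1) + m.+2)%N by exists (d - (n - i.+1).+2)%N; lia.
rewrite (_ : _ - _ = m.+2)%N; last lia.
rewrite (_ : _ - _.+1 = m.+1)%N; last lia.
rewrite (_ : _ - _.+2 = m)%N; last lia.
by rewrite !expnS; lia.
Qed.

(** * Matrices whose right kernel is generated by one polynomial *)

(** When [1 < n], [i < k] and [size p <= i.+1], this says that the [k - i] shifts [p * 'X^a] lie in
    the right kernel; a single range of exponents replaces the pairs of a shift and a row. *)
Definition ann n k i (c p : {poly F}) : bool :=
  [forall j : 'I_(n + 2 * (k - i).-1), pairing c ((p \Po 'X^2) * 'X^j) == 0].

Lemma pairing_mul0 N (c q g : {poly F}) :
    (forall j, (j < N)%N -> pairing c (q * 'X^j) = 0) -> (size g <= N)%N ->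
  pairing c (q * g) = 0.
Proof.
move=> h sg; rewrite -[g]coefK poly_def mulr_sumr pairing_sum big1 // => j _.
by rewrite -scalerAr pairingZ h ?mulr0 // (leq_trans (ltn_ord j)).
Qed.

Lemma ann_pairing n k i (c p g : {poly F}) : ann n k i c p ->
  (size g <= n + 2 * (k - i).-1)%N -> pairing c ((p \Po 'X^2) * g) = 0.
Proof.
move=> /forallP h; apply: pairing_mul0 => j hj; apply/eqP; exact: (h (Ordinal hj)).
Qed.

Lemma inL_pairing n k (c w x : {poly F}) : inL n k c w -> (size x <= k)%N ->
  pairing c (w * (x \Po 'X^2)) = 0.
Proof.
move=> /inLP[_ h] sx; rewrite comp_polyE mulr_sumr pairing_sum big1 // => j _.
by rewrite -scalerAr pairingZ -exprM h ?mulr0 // (leq_trans (ltn_ord j)).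
Qed.

Lemma size_mul_bound (x y : {poly F}) a b :
  (size x <= a)%N -> (size y <= b)%N -> (size (x * y)%R <= (a + b).-1)%N.
Proof. by move=> sx sy; rewrite (leq_trans (size_polyMleq _ _)) //; lia. Qed.

Lemma ann_inK n k i (c p : {poly F}) : (1 < n)%N -> (i < k)%N -> (size p <= i.+1)%N ->
  ann n k i c p <-> forall a, (a < k - i)%N -> inK n k c (p * 'X^a).
Proof.
move=> n1 ik sp; split=> [h a ha|h].
  apply/inKP; split; first by rewrite size_mulXn_le; apply/orP; right; lia.
  move=> t ht; rewrite comp_mulX2 -mulrA -exprD (ann_pairing _ _ _ _ _ _ h) // size_polyXn; lia.
(* The exponent [j] is split as [2 * a + t] with [a < k - i] and [t < n]; since [1 < n], consecutive
   blocks leave no gap. *)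
apply/forallP => j; pose a := minn (j %/ 2) (k - i).-1.
have ha : (a < k - i)%N by rewrite /a; lia.
have /inKP[_ H] := h a ha; have ht : (j - 2 * a < n)%N by have := ltn_ord j; rewrite /a; lia.
have := H _ ht; rewrite comp_mulX2 -mulrA -exprD subnKC => [->//|].
by rewrite /a; lia.
Qed.

(** The kernel has dimension [k - i], so only its generator can be shifted [k - i - 1] times without
    leaving it; a multiple of positive degree would overrun the degree bound. *)
Lemma cyclic_ann n k i (c w p : {poly F}) d : (1 < n)%N -> (i < k)%N ->
    \rank (hank n k c) = i -> cyclic 1 d w (inK n k c) -> p != 0 ->
  (size p <= i.+1)%N && ann n k i c p = (p == w).
Proof.
move=> n1 ik rk [w0 hK] p0.
have hd : d = (k - i)%N.
  have := @cnt_cyclic 1 k d w _ isT w0 (inK_size n k c) hK.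
  by rewrite cnt_inK rk => /eqP; rewrite eqn_exp2l // => /eqP.
have hK' g : inK n k c g <-> exists2 r : {poly F}, (size r <= k - i)%N & g = r * w.
  split=> [/hK[r]|[r sr ->]]; first by rewrite hd expr1 comp_polyXr; exists r.
  by apply/hK; exists r; rewrite ?hd // expr1 comp_polyXr.
have sw : (size w <= i.+1)%N.
  have /inK_size : inK n k c ('X^((k - i).-1) * w).
    by apply/hK'; exists 'X^((k - i).-1) => //; rewrite size_polyXn; lia.
  by rewrite mulrC size_mulXn_le (negbTE w0) /=; lia.
apply/andP/eqP => [[sp /(ann_inK _ _ _ _ _ n1 ik sp) h]|->]; last first.
  split=> //; apply/ann_inK => // a ha; apply/hK'; exists 'X^a; rewrite ?size_polyXn //.
  exact: mulrC.
have /hK'[r sr E] : inK n k c p by have := h 0%N; rewrite expr0 mulr1 subn_gt0; apply.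
have /hK'[r' sr'] : inK n k c (p * 'X^((k - i).-1)) by apply: h; lia.
rewrite E mulrAC => /(mulIf w0) E'; move: sr'; rewrite -E' size_mulXn_le.
have r0 : r != 0 by apply: contraNneq p0 => r0; rewrite E r0 mul0r.
rewrite (negbTE r0) /= => sr'; have /size1_polyC r1 : (size r <= 1)%N.
  by rewrite -(leq_add2r (k - i).-1) (leq_trans sr') //; lia.
move: r0; rewrite r1 polyC_eq0 => /F2_neq0 ->; by rewrite mul1r.
Qed.

Definition seqlen n k := (n + 2 * k.-1)%N.

(** Here [i] is the rank targeted by the defect, while [l] is the rank of the matrices summed over
    and [p] the candidate generator of their right kernel. *)
Definition ann_sum n k i l (p : {poly F}) : int :=
  \sum_(c : 'rV[F]_(seqlen n k) |
          ann n k l (rVpoly c) p && (\rank (hank n k (rVpoly c)) == l))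
     defect n k i (rVpoly c).

(** Ranks above [i] and cyclic left kernels contribute 0. Every other matrix has a cyclic right
    kernel and, by [cyclic_ann], is counted at exactly one [p]. *)
Lemma sum_defect n k i : (1 < n)%N -> (i < n)%N -> (i < k)%N ->
  \sum_(c : 'rV[F]_(seqlen n k)) defect n k i (rVpoly c) =
  \sum_(l < i.+1) \sum_(p : 'rV[F]_l.+1 | rVpoly p != 0) ann_sum n k i l (rVpoly p).
Proof.
move=> n1 hin ik; have k0 : (0 < k)%N by lia.
have E (c : {poly F}) : defect n k i c =
    \sum_(l < i.+1) \sum_(p : 'rV[F]_l.+1 | rVpoly p != 0)
      if ann n k l c (rVpoly p) && (\rank (hank n k c) == l) then defect n k i c else 0.
  have [hr|hr] := leqP (\rank (hank n k c)) i; last first.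
    rewrite (defect_large _ _ _ _ k0 hin hr).
    by rewrite big1 // => l _; rewrite big1 // => p _; rewrite if_same.
  pose l0 : 'I_i.+1 := Ordinal (hr : (_ < i.+1)%N).
  rewrite (bigD1 l0) //= [X in _ = _ + X]big1 ?addr0 => [|l ll0]; last first.
    rewrite big1 // => p _; rewrite (_ : (_ == _) = false) ?andbF //.
    by apply: contraNF ll0 => /eqP ll0; apply/eqP/val_inj.
  have [[w [d hK]]|[w [d hL]]] := cyclic_inK_or_inL n k c n1 k0; last first.
    by rewrite (defect_cyclic _ _ _ _ _ _ k0 hin hL) big1 // => p _; rewrite if_same.
  have lk : (\rank (hank n k c) < k)%N by lia.
  have [w0 _] := hK.
  have := cyclic_ann _ _ _ _ _ w _ n1 lk erefl hK w0; rewrite eqxx => /andP[sw aw].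
  rewrite (bigD1 (poly_rV w)) /=; last by rewrite poly_rV_K.
  rewrite poly_rV_K // aw eqxx /= big1 ?addr0 // => p /andP[p0 pw].
  have := cyclic_ann _ _ _ _ _ _ _ n1 lk erefl hK p0; rewrite size_rVpoly /= => ->.
  rewrite (_ : (_ == w) = false) //; apply: contraNF pw => /eqP <-.
  by rewrite rVpolyK.
rewrite (eq_bigr _ (fun c _ => E (rVpoly c))) exchange_big /=; apply: eq_bigr => l _.
by rewrite exchange_big /=; apply: eq_bigr => p _; rewrite -big_mkcond.
Qed.

(** * Transport between different numbers of columns *)

Definition cof m (p : {poly F}) : {poly F} := 1 + 'X^(m - (size p).-1) * p.

Lemma size_cof m (p : {poly F}) : p != 0 -> ((size p).-1 < m)%N -> size (cof m p) = m.+1.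
Proof.
move=> p0 hm; have sp : (0 < size p)%N by rewrite size_poly_gt0.
rewrite /cof addrC size_polyDl mulrC size_mulXn // ?size_poly1; lia.
Qed.

Lemma cof_comp m (p : {poly F}) : p != 0 -> (cof m p) \Po 'X^2 = cof (2 * m) (p \Po 'X^2).
Proof.
move=> p0; rewrite /cof linearD /= comp_polyC comp_polyM comp_Xn_poly -exprM.
by rewrite size_compXn // mulnC mulnBl /= [(m * 2)%N]mulnC.
Qed.

(* [cof m p] is congruent to 1 modulo [p] and has exact degree [m], so it is coprime to [p]
   also at infinity. *)
Lemma cof_split m k i (p q : {poly F}) :
    p != 0 -> ((size p).-1 < m)%N -> (size p <= i.+1)%N -> (i <= k)%N ->
    (size q <= k + m)%N ->
  exists x y, [/\ q = cof m p * x + p * y, (size x <= k)%N & (size y <= k + m - i)%N].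
Proof.
move=> p0 pm spi ik sq; have sp : (0 < size p)%N by rewrite size_poly_gt0.
pose f := cof m p; have sf : size f = m.+1 by apply: size_cof.
have f0 : f != 0 by rewrite -size_poly_eq0 sf.
pose R : {poly F} := q %% f; have sR : (size R <= m)%N by rewrite -ltnS -sf ltn_modp.
have sRp : (size (R %% p)%R < size p)%N by rewrite ltn_modp.
(* After division by [f], the remainder [R] is divided by [p]. As [f] is 1 plus a multiple of [p],
   replacing [R %% p] by [f * (R %% p)] costs a multiple of [p], absorbed in [y]. *)
exists (q %/ f + R %% p), (R %/ p - 'X^(m - (size p).-1) * (R %% p)); split.
- rewrite mulrDr -/f [f * (q %/ f)]mulrC {1}(divp_eq q f) -/R -addrA; congr (_ + _).
  rewrite {1}(divp_eq R p) /f /cof; ring.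
- rewrite (leq_trans (size_polyD _ _)) // geq_max size_divp // sf leq_subLR addnC sq /=.
  by rewrite (leq_trans _ ik) // -ltnS (leq_trans sRp).
- rewrite (leq_trans (size_polyD _ _)) // geq_max size_polyN size_divp // mulrC size_mulXn_le.
  have sm : (m <= k + m - i)%N by lia.
  rewrite (leq_trans _ sm) ?(leq_trans (leq_subr _ _)) //=; apply/orP; right.
  by rewrite (leq_trans _ sm) // -[X in (_ <= X)%N](subnKC (ltnW pm)) leq_add2r -ltnS prednK.
Qed.

Section Transport.
Variables (n k m i : nat) (p : {poly F}).
Hypotheses (n1 : (1 < n)%N) (ik : (i < k)%N) (im : (i < m)%N).
Hypotheses (p0 : p != 0) (sp : (size p <= i.+1)%N).

Let f2 := (cof m p) \Po 'X^2.
(** The degree [2 * m] of [f2] is the difference between the sequence lengths for [k + m] and for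
    [k] columns. *)
Let phi (c : {poly F}) := contract (seqlen n k) f2 c.

Lemma size_cof_comp : size f2 = (2 * m).+1.
Proof.
rewrite /f2 size_compXn // ?size_cof //; try lia.
by rewrite -size_poly_eq0 size_cof //; lia.
Qed.

(** By [cof_split], a polynomial of size at most [k + m] is a multiple of [cof m p] plus a multiple
    of [p]. After substituting ['X^2], [c] kills the second part and acts on the first as
    [phi c]. *)
Lemma inL_transport c w : ann n (k + m) i c p -> inL n (k + m) c w = inL n k (phi c) w.
Proof.
move=> hc; apply/idP/inLP => [h|[sw h]].
  split=> [|a ha]; first exact: inL_size h.
  rewrite pairing_contract; last first.
    by rewrite size_mulXn_le /seqlen; have := inL_size _ _ _ _ h; lia.
  rewrite mulrCA /f2 exprM -(comp_Xn_poly _ a) -comp_polyM (inL_pairing _ _ _ _ _ h) //.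
  rewrite (leq_trans (size_mul_bound _ _ m.+1 a.+1 _ _)) ?size_polyXn ?size_cof //; lia.
apply/inLP; split=> // a ha.
have [||||x [y [E sx sy]]] := cof_split m k i p 'X^a p0 => //; try lia.
  by rewrite size_polyXn; lia.
have -> : 'X^(2 * a) = f2 * (x \Po 'X^2) + (p \Po 'X^2) * (y \Po 'X^2) :> {poly F}.
  by rewrite /f2 -!comp_polyM -linearD /= -E comp_Xn_poly exprM.
rewrite mulrDr pairingD [X in _ + X](_ : _ = 0) ?addr0.
  rewrite mulrCA -(@pairing_contract (seqlen n k)).
    by apply: (@inL_pairing n k) => //; apply/inLP.
  have sx2 := size_compXn_le x 2 k isT sx.
  by rewrite (leq_trans (size_mul_bound _ _ _ _ sw sx2)) // /seqlen; lia.
rewrite mulrCA (ann_pairing _ _ _ _ _ _ hc) //.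
have sy2 := size_compXn_le y 2 _ isT sy.
by rewrite (leq_trans (size_mul_bound _ _ _ _ sw sy2)) //; lia.
Qed.

Lemma ann_transport c : ann n (k + m) i c p -> ann n k i (phi c) p.
Proof.
move=> hc; apply/forallP => j; have hj := ltn_ord j.
have sp2 := size_compXn_le p 2 _ isT sp.
rewrite pairing_contract; last first.
  by rewrite size_mulXn_le /seqlen; apply/orP; right; move: sp2 hj; lia.
rewrite mulrCA (ann_pairing _ _ _ _ _ _ hc) //.
by rewrite size_mulXn_le size_cof_comp; apply/orP; right; move: hj; lia.
Qed.

Lemma rank_transport c : ann n (k + m) i c p ->
  \rank (hank n (k + m) c) = \rank (hank n k (phi c)).
Proof.
move=> hc; have := cnt_eq n _ _ (fun w => inL_transport c w hc).
rewrite !cnt_inL => /eqP; rewrite eqn_exp2l // => /eqP.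
by have := rank_leq_row (hank n (k + m) c); have := rank_leq_row (hank n k (phi c)); lia.
Qed.

Lemma lcnt_transport j c : ann n (k + m) i c p -> lcnt n (k + m) j c = lcnt n k j (phi c).
Proof.
move=> hc; have k0 : (0 < k)%N by lia.
have k1 : (0 < k + m)%N by lia.
apply: cnt_eq => w; apply/(inL_tower _ _ _ _ _ k1)/(inL_tower _ _ _ _ _ k0) => h a ha.
  by rewrite -inL_transport // h.
by rewrite inL_transport // h.
Qed.

Lemma defect_transport j c : ann n (k + m) i c p ->
  defect n (k + m) j c = defect n k j (phi c).
Proof. by move=> hc; rewrite /defect /prim rank_transport // !lcnt_transport. Qed.

(** The sequence length exceeds the number of independent conditions by [2 * i], whatever [K] is. *)
Lemma card_ann K : (i < K)%N ->
  #|[set c : 'rV[F]_(seqlen n K) | ann n K i (rVpoly c) p]| = (2 ^ (2 * i))%N.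
Proof.
move=> iK; have sp2 := size_compXn_le p 2 _ isT sp.
have p20 : p \Po 'X^2 != 0 by rewrite comp_poly_eq0 // size_polyXn.
have sp0 : (0 < size (p \Po 'X^2))%N by rewrite size_poly_gt0.
set M := (n + 2 * (K - i).-1)%N.
have eN : seqlen n K = (2 * i + M)%N by rewrite /seqlen /M; lia.
apply/eqP; rewrite -(eqn_pmul2r (_ : 0 < 2 ^ M)%N) ?expn_gt0 // -expnD -eN; apply/eqP.
apply: (@card_annihilator _ _ (fun j => (p \Po 'X^2) * 'X^j)).
  move=> j hj; rewrite !size_mulXn // addn_gt0 sp0 orbT /=.
  by apply: leq_trans (leq_add (leqnn j) sp2) _; rewrite eN; lia.
by move=> j l /andP[jl _]; rewrite !size_mulXn // ltn_add2r.
Qed.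

Lemma ann_sum_transport j : ann_sum n (k + m) j i p = ann_sum n k j i p.
Proof.
pose h (c : 'rV[F]_(seqlen n (k + m))) : 'rV[F]_(seqlen n k) := poly_rV (phi (rVpoly c)).
have hE c : rVpoly (h c) = phi (rVpoly c) by rewrite poly_rV_K // size_poly.
pose A := [set c : 'rV[F]_(seqlen n (k + m)) | ann n (k + m) i (rVpoly c) p].
pose B := [set c : 'rV[F]_(seqlen n k) | ann n k i (rVpoly c) p].
have hinj : {in A &, injective h}.
  move=> c d; rewrite !inE => hc hd /(congr1 (@rVpoly F _)); rewrite !hE => E.
  apply: rVpoly_inj; apply/eqP; rewrite -addp_eq0; apply/eqP/polyP => a; rewrite coef0.
  have [ha|ha] := leqP (seqlen n (k + m)) a.
    by rewrite coefD !nth_default ?addr0 // (leq_trans (size_rVpoly _ _)).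
  rewrite -pairingXn.
  (* At doubled sizes [cof_split] applies to [p \Po 'X^2], so each term of a sequence annihilated by
     [p] can be recovered from the contraction. *)
  have [|||||x [y [-> sx sy]]] := cof_split (2 * m) (seqlen n k) (2 * i) (p \Po 'X^2) 'X^a.
  - by rewrite comp_poly_eq0 // size_polyXn.
  - have spi : ((size p).-1 <= i)%N by rewrite -subn1 leq_subLR add1n.
    by rewrite size_compXn // mulnC ltn_mul2l (leq_ltn_trans spi im).
  - by have := size_compXn_le p 2 _ isT sp; lia.
  - by rewrite /seqlen; lia.
  - by rewrite size_polyXn; move: ha; rewrite /seqlen; lia.
  rewrite -cof_comp // pairingD !pairingDl -!(pairing_contract _ _ _ _ sx) -/f2.
  rewrite -/(phi (rVpoly c)) -/(phi (rVpoly d)) E.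
  have sy' : (size y <= n + 2 * (k + m - i).-1)%N.
    by apply: leq_trans sy _; rewrite /seqlen; lia.
  rewrite (ann_pairing _ _ _ _ _ _ hc sy') (ann_pairing _ _ _ _ _ _ hd sy') !addr0.
  by rewrite -mulr2n mulrn_pchar // pchar_Fp.
(* By [card_ann] both sets have [2 ^ (2 * i)] elements, so the injection is onto. *)
have hAB : h @: A = B.
  apply/eqP; rewrite eqEcard card_in_imset // !card_ann ?leqnn ?andbT //; last lia.
  apply/subsetP => _ /imsetP[c hc ->]; rewrite !inE in hc *.
  by rewrite hE ann_transport.
rewrite /ann_sum.
transitivity (\sum_(c in B) if \rank (hank n k (rVpoly c)) == i
                            then defect n k j (rVpoly c) else 0); last first.
  by rewrite -big_mkcondr; apply: eq_bigl => c; rewrite inE.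
rewrite -hAB big_imset //= -big_mkcondr /=; apply: eq_big => [c|c /andP[hc _]].
  by rewrite inE hE; case: (boolP (ann _ _ _ _ _)) => //= hc; rewrite rank_transport.
by rewrite hE defect_transport.
Qed.
End Transport.

Lemma sum_defect_const n k k' i : (1 < n)%N -> (i < n)%N -> (i < k)%N -> (i < k')%N ->
  \sum_(c : 'rV[F]_(seqlen n k)) defect n k i (rVpoly c) =
  \sum_(c : 'rV[F]_(seqlen n k')) defect n k' i (rVpoly c).
Proof.
move=> n1 hi.
have step K m : (i < K)%N -> (i < m)%N ->
    \sum_(c : 'rV[F]_(seqlen n (K + m))) defect n (K + m) i (rVpoly c) =
    \sum_(c : 'rV[F]_(seqlen n K)) defect n K i (rVpoly c).
  move=> iK im; rewrite !sum_defect //; last lia.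
  apply: eq_bigr => l _; apply: eq_bigr => p p0; have := ltn_ord l => hl.
  by rewrite ann_sum_transport ?size_rVpoly //; lia.
(* Both [k] and [k'] are compared with [k + k' + i.+1], because transport needs an increment larger
   than [i]. *)
move=> ik ik'; rewrite -(step k (k' + i.+1)%N) ?ltn_addl //.
by rewrite -(step k' (k + i.+1)%N) ?ltn_addl // !addnA [(k + k')%N]addnC.
Qed.

(** * Double counting of matrices and kernel vectors *)

Definition rkcount n k r :=
  #|[set c : 'rV[F]_(seqlen n k) | \rank (hank n k (rVpoly c)) == r]|.

Lemma sum_by_rank n k b (f : nat -> nat) :
    (forall c : {poly F}, (\rank (hank n k c) <= b)%N) ->
  (\sum_(c : 'rV[F]_(seqlen n k)) f (\rank (hank n k (rVpoly c))) =
   \sum_(r < b.+1) f r * rkcount n k r)%N.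
Proof.
move=> hb; pose h (c : 'rV[F]_(seqlen n k)) : 'I_b.+1 := Ordinal (hb (rVpoly c) : (_ < b.+1)%N).
rewrite (partition_big h xpredT) //=; apply: eq_bigr => r _.
rewrite (eq_bigr (fun _ => f r)) => [|c /eqP <-//].
by rewrite sum_nat_const mulnC; congr (_ * _)%N; apply: eq_card => c; rewrite inE.
Qed.

Lemma sum_cnt N m (P : {poly F} -> pred {poly F}) :
  (\sum_(c : 'rV[F]_N) cnt m (P (rVpoly c)) =
   \sum_(v : 'rV[F]_m) cnt N (fun c => P c (rVpoly v)))%N.
Proof.
rewrite /cnt; under eq_bigr do rewrite -sum1dep_card big_mkcond /=.
under [in RHS]eq_bigr do rewrite -sum1dep_card big_mkcond /=.
exact: exchange_big.
Qed.

Lemma sum_nonzero_const N m (f : 'rV[F]_m -> nat) x :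
  f 0 = (2 ^ N)%N -> (forall v, v != 0 -> f v = x) ->
  (\sum_v f v = 2 ^ N + (2 ^ m - 1) * x)%N.
Proof.
move=> f0 fx; rewrite (bigD1 0) //= f0 (eq_bigr (fun=> x)) // sum_nat_const.
by rewrite cardC1 card_rV subn1.
Qed.

(** The zero vector gives the first summand. Any other imposes [n] independent conditions, leaving
    [2 * k.-1] free dimensions. *)
Lemma sum_cnt_inK n k : (0 < k)%N ->
  (\sum_(c : 'rV[F]_(seqlen n k)) cnt k (inK n k (rVpoly c)) =
   2 ^ seqlen n k + (2 ^ k - 1) * 2 ^ (2 * k.-1))%N.
Proof.
move=> k0; rewrite sum_cnt; apply: sum_nonzero_const => [|v v0].
  rewrite /cnt -card_rV -cardsT; apply: eq_card => c.
  by rewrite !inE linear0 inK0.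
have p0 : rVpoly v \Po 'X^2 != 0.
  rewrite comp_poly_eq0 ?size_polyXn // -(linear0 (@rVpoly F k)).
  by rewrite (inj_eq (@rVpoly_inj k)).
have s0 : (0 < size (rVpoly v \Po 'X^2))%N by rewrite size_poly_gt0.
have := @card_annihilator (seqlen n k) n (fun t => (rVpoly v \Po 'X^2) * 'X^t).
rewrite (expnD 2 n) [(2 ^ n * _)%N]mulnC => H.
apply/eqP; rewrite -(eqn_pmul2r (_ : 0 < 2 ^ n)%N) ?expn_gt0 // -H.
- by apply/eqP; congr (_ * _)%N; apply: cnt_eq => c; rewrite /inK size_rVpoly.
- move=> t ht; rewrite size_mulXn // addn_gt0 s0 orbT /=.
  apply: leq_trans (leq_add (leqnn t) (size_compXn_le _ 2 k isT (size_rVpoly _ v))) _.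
  by rewrite /seqlen; lia.
- by move=> j l /andP[jl _]; rewrite !size_mulXn // ltn_add2r.
Qed.

(** A nonzero [w] imposes [k + j] independent conditions. If [n <= 2 * j], only [w = 0] exists and
    the factor [2 ^ 0 - 1] cancels the possibly truncated exponent. *)
Lemma sum_lcnt n k j : (0 < k)%N ->
  (\sum_(c : 'rV[F]_(seqlen n k)) lcnt n k j (rVpoly c) =
   2 ^ seqlen n k + (2 ^ (n - 2 * j) - 1) * 2 ^ (n + k - 2 - j))%N.
Proof.
move=> k0; have [n0|n0] := posnP (n - 2 * j).
  rewrite n0 mul0n addn0 -card_rV -sum1_card; apply: eq_bigr => c _.
  rewrite /lcnt n0; apply/eqP/cards1P; exists 0; apply/setP => v.
  by rewrite !inE [v]thinmx0 eqxx linear0 inL0.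
rewrite /lcnt (sum_cnt _ _ (inL (n - 2 * j) (k + j))).
apply: sum_nonzero_const => [|v v0].
  rewrite /cnt -card_rV -cardsT; apply: eq_card => c.
  by rewrite !inE linear0 inL0.
have w0 : rVpoly v != 0.
  by rewrite -(linear0 (@rVpoly F (n - 2 * j))) (inj_eq (@rVpoly_inj _)).
have s0 : (0 < size (rVpoly v))%N by rewrite size_poly_gt0.
have eN : seqlen n k = (n + k - 2 - j + (k + j))%N by rewrite /seqlen; lia.
apply/eqP; rewrite -(eqn_pmul2r (_ : 0 < 2 ^ (k + j))%N) ?expn_gt0 // -expnD -eN.
rewrite -(@card_annihilator (seqlen n k) (k + j) (fun m => rVpoly v * 'X^(2 * m))).
- by apply/eqP; congr (_ * _)%N; apply: cnt_eq => c; rewrite /inL size_rVpoly.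
- move=> t ht; rewrite size_mulXn // addn_gt0 s0 orbT /=.
  by apply: leq_trans (leq_add (leqnn _) (size_rVpoly _ v)) _; rewrite eN; lia.
- by move=> a l /andP[al _]; rewrite !size_mulXn // ltn_add2r; lia.
Qed.

Lemma sum_rkcount n k b : (0 < k)%N ->
    (forall c : {poly F}, (\rank (hank n k c) <= b)%N) ->
  (\sum_(r < b.+1) rkcount n k r = 2 ^ seqlen n k)%N.
Proof.
move=> k0 hb; have := sum_by_rank n k b (fun=> 1%N) hb.
rewrite sum1_card card_rV => ->; by apply: eq_bigr => r _; rewrite mul1n.
Qed.

Lemma sum_rkcount_kernel n k : (0 < k)%N ->
  (\sum_(r < k.+1) 2 ^ (k - r) * rkcount n k r =
   2 ^ seqlen n k + (2 ^ k - 1) * 2 ^ (2 * k.-1))%N.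
Proof.
move=> k0; rewrite -sum_cnt_inK // -(sum_by_rank n k k (fun r => 2 ^ (k - r))%N).
  by apply: eq_bigr => c _; rewrite cnt_inK.
by move=> c; apply: rank_leq_col.
Qed.

Definition primsum n k j : int := ((2 ^ (n - 2 * j) - 1) * 2 ^ (n + k - 2 - j))%N%:Z.

(** Both sides are minus the sum of the defects, which is the same for all numbers of columns above
    [i]; the contribution of [w = 0] drops out since [1 - 3 + 2 = 0]. *)
Lemma rkcount_shift n k k' i : (1 < n)%N -> (i < n)%N -> (i < k)%N -> (i < k')%N ->
  let Pr K := primsum n K (n - i.+1) - 3 * primsum n K (n - i.+1).+1
              + 2 * primsum n K (n - i.+1).+2 in
  (rkcount n k i)%:Z - Pr k = (rkcount n k' i)%:Z - Pr k' :> int.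
Proof.
move=> n1 hi ik ik' Pr.
have E K : (i < K)%N -> (rkcount n K i)%:Z - Pr K =
    - \sum_(c : 'rV[F]_(seqlen n K)) defect n K i (rVpoly c).
  move=> iK; rewrite /defect /prim sumrB big_split sumrB /= -!mulr_sumr.
  have S j : \sum_(c : 'rV[F]_(seqlen n K)) (lcnt n K j (rVpoly c))%:Z =
      (2 ^ seqlen n K)%N%:Z + primsum n K j.
    rewrite /primsum -PoszD -sum_lcnt; last lia.
    by rewrite (big_morph Posz PoszD erefl).
  rewrite !S.
  have -> : \sum_(c : 'rV[F]_(seqlen n K)) (\rank (hank n K (rVpoly c)) == i : nat)%:Z =
      (rkcount n K i)%:Z.
    rewrite /rkcount -sum1dep_card (big_morph Posz PoszD erefl) /=.
    by rewrite [RHS]big_mkcond; apply: eq_bigr => c _; case: eqP.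
  by rewrite /Pr; lia.
by rewrite !E // (sum_defect_const _ _ k').
Qed.

(** * From pairs of persymmetric matrices to sequences *)

(** Row [minn a m] is the lowest one on antidiagonal [a], which keeps the column index in range
    whenever [a <= m + n]. *)
Definition antidiag m n (A : 'M[F]_(m.+1, n.+1)) a : F :=
  A (inord (minn a m)) (inord (a - minn a m)).

Lemma persymmetric_antidiag m n (A : 'M[F]_(m.+1, n.+1)) i j :
  persymmetric A -> A i j = antidiag m n A (i + j).
Proof.
move=> /forallP/(_ i)/forallP/(_ j)/forallP h.
have /forallP := h (inord (minn (i + j) m)).
move/(_ (inord (i + j - minn (i + j) m)))/implyP => H; apply/eqP/H.
have hi := ltn_ord i; have hj := ltn_ord j.
by rewrite !inordK ?ltnS; lia.
Qed.

(** The rows of [hank] alternate between the blocks, starting and ending with an even index; hence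
    the even terms belong to the block with [s.+1] rows. *)
Definition double_hank s k (c : {poly F}) : 'M[F]_(s + s.+1, k) :=
  col_mx (\matrix_(i, j) c`_(2 * (i + j) + 1)) (\matrix_(i, j) c`_(2 * (i + j))).

Lemma rank_double_hank s k c : \rank (double_hank s k c) = \rank (hank (2 * s + 1) k c).
Proof.
apply/eqP; rewrite eqn_leq; apply/andP; split; apply: mxrankS; apply/row_subP => t.
- rewrite -[t]splitK; case: (split t) => i /=.
    have hi : (2 * i + 1 < 2 * s + 1)%N by have := ltn_ord i; lia.
    rewrite (_ : row _ _ = row (Ordinal hi) (hank (2 * s + 1) k c)) ?row_sub //.
    by apply/rowP => j; rewrite [LHS]mxE col_mxEu !mxE /=; congr (_`_ _); lia.
  have hi : (2 * i < 2 * s + 1)%N by have := ltn_ord i; lia.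
  rewrite (_ : row _ _ = row (Ordinal hi) (hank (2 * s + 1) k c)) ?row_sub //.
  by apply/rowP => j; rewrite [LHS]mxE col_mxEd !mxE /=; congr (_`_ _); lia.
- have ht := ltn_ord t; have [todd|teven] := boolP (odd t).
    have hi : (t./2 < s)%N by lia.
    rewrite (_ : row _ _ = row (lshift _ (Ordinal hi)) (double_hank s k c)) ?row_sub //.
    apply/rowP => j; rewrite [RHS]mxE col_mxEu !mxE /=; congr (_`_ _); lia.
  have hi : (t./2 < s.+1)%N by lia.
  rewrite (_ : row _ _ = row (rshift _ (Ordinal hi)) (double_hank s k c)) ?row_sub //.
  apply/rowP => j; rewrite [RHS]mxE col_mxEd !mxE /=; congr (_`_ _); lia.
Qed.

(** The blocks have [s + k - 1] and [s + k] antidiagonals, in total [seqlen (2 * s + 1) k], so pairs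
    of persymmetric matrices correspond bijectively to sequences. *)
Lemma Gamma_rkcount s k i : (0 < s)%N -> (0 < k)%N ->
  Gamma s k i = rkcount (2 * s + 1) k i.
Proof.
case: s k => [//|s] [//|k] _ _.
pose h (c : 'rV[F]_(seqlen (2 * s.+1 + 1) k.+1)) := double_hank s.+1 k.+1 (rVpoly c).
have hinj : injective h.
  move=> c d E; apply: rVpoly_inj; apply/polyP => a.
  have [ha|ha] := leqP (seqlen (2 * s.+1 + 1) k.+1) a.
    by rewrite !nth_default // (leq_trans (size_rVpoly _ _)).
  rewrite /seqlen in ha.
  have [u v] := eq_col_mx E; have [aodd|aeven] := boolP (odd a).
    have /matrixP/(_ (inord (minn a./2 s)) (inord (a./2 - minn a./2 s))) := u.
    rewrite !mxE !inordK ?ltnS; try lia.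
    by rewrite (_ : 2 * (_ + (_ - _)) + 1 = a)%N; last lia.
  have /matrixP/(_ (inord (minn a./2 s.+1)) (inord (a./2 - minn a./2 s.+1))) := v.
  rewrite !mxE !inordK ?ltnS; try lia.
  by rewrite (_ : 2 * (_ + (_ - _)) = a)%N; last lia.
rewrite /rkcount -(card_imset _ hinj); apply: eq_card => M.
rewrite [LHS]inE; apply/andP/imsetP => [[/imset2P[A B pA pB ->] rk]|[c hc ->]]; last first.
  rewrite inE in hc; rewrite rank_double_hank hc; split=> //; apply/imset2P.
  exists (\matrix_(i, j) (rVpoly c)`_(2 * (i + j) + 1))
         (\matrix_(i, j) (rVpoly c)`_(2 * (i + j))) => //;
  rewrite unfold_in; apply/forallP => a; apply/forallP => b;
  apply/forallP => a'; apply/forallP => b'; apply/implyP => /eqP E; by rewrite !mxE E.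
pose c : {poly F} := \poly_(j < seqlen (2 * s.+1 + 1) k.+1)
  (if odd j then antidiag _ _ A j./2 else antidiag _ _ B j./2).
have E : double_hank s.+1 k.+1 c = col_mx A B.
  congr col_mx; apply/matrixP => a b; rewrite mxE coef_poly /seqlen ifT.
  - rewrite addn1 /= oddM /= (persymmetric_antidiag _ _ _ _ _ pA).
    by congr (antidiag _ _ _ _); lia.
  - by have := ltn_ord a; have := ltn_ord b; lia.
  - rewrite oddM /= (persymmetric_antidiag _ _ _ _ _ pB).
    by congr (antidiag _ _ _ _); lia.
  - by have := ltn_ord a; have := ltn_ord b; lia.
have cE : rVpoly (poly_rV c : 'rV[F]_(seqlen (2 * s.+1 + 1) k.+1)) = c.
  by rewrite poly_rV_K // size_poly.
exists (poly_rV c); last by rewrite /h cE E.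
by rewrite inE cE -rank_double_hank E.
Qed.

(** * Closed forms and the recursion that determines them *)

(** The variable [q] stands for [2 ^ k]: each branch is affine in [q], and [q = 0] isolates the part
    independent of [k]. The last branch is meant for [s + 2 <= r <= 2 * s]. *)
Definition closed_form (s r : nat) (q : rat) : rat :=
  let x : rat := 2 ^+ s in let y : rat := 2 ^+ r in
  if r == 0%N then 1
  else if (r < s)%N then 21 / 16 * y ^+ 3 - 3 / 8 * y ^+ 2
  else if r == s then q * x / 2 + 21 / 16 * x ^+ 3 - 11 / 8 * x ^+ 2
  else if r == s.+1 then 11 / 2 * q * x + 21 / 2 * x ^+ 3 - 53 / 2 * x ^+ 2
  else 21 * (q * y ^+ 3 / (32 * x ^+ 2) + y ^+ 3 / 16 - 5 * y ^+ 4 / (64 * x ^+ 2)).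

Definition closed_sum (s i : nat) (q : rat) : rat :=
  let x : rat := 2 ^+ s in let y : rat := 2 ^+ i in
  if (i < s)%N then 3 / 2 * y ^+ 3 - y ^+ 2 / 2
  else if i == s then 3 / 2 * x ^+ 3 - 3 / 2 * x ^+ 2 + q * x / 2
  else 3 / 4 * q * y ^+ 3 / x ^+ 2 + 3 / 2 * y ^+ 3 - 7 / 4 * y ^+ 4 / x ^+ 2.

Definition closed_wsum (s i : nat) (q : rat) : rat :=
  let x : rat := 2 ^+ s in let y : rat := 2 ^+ i in
  if (i < s)%N then 7 / 4 * y ^+ 2 - 3 / 4 * y
  else if i == s then 7 / 4 * x ^+ 2 - 7 / 4 * x + q / 2
  else 7 / 8 * q * y ^+ 2 / x ^+ 2 + 7 / 4 * y ^+ 2 - 15 / 8 * y ^+ 3 / x ^+ 2 - q / 4.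

Lemma closed_form_sums s i q : (0 < s)%N ->
  \sum_(r < i.+1) closed_form s r q = closed_sum s i q /\
  \sum_(r < i.+1) closed_form s r q / 2 ^+ r = closed_wsum s i q.
Proof.
move=> s0; elim: i => [|i [IH1 IH2]].
  by rewrite !big_ord1 /closed_form /closed_sum /closed_wsum eqxx s0 !expr0; split; field.
rewrite big_ord_recr [X in _ /\ X = _]big_ord_recr /= {}IH1 {}IH2.
have y0 : (2 : rat) ^+ i != 0 by rewrite expf_neq0.
have x0 : (2 : rat) ^+ s != 0 by rewrite expf_neq0.
rewrite /closed_form /closed_sum /closed_wsum /=.
have [h|h|h] := ltngtP i.+1 s.
- by rewrite !exprS; split; field.
(* Rank [s.+1] has its own branch in [closed_form], although the sums obey a single formula from
   there on. *)
- have [e|ne] := eqVneq i s.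
    rewrite e (_ : (s.+1 == s.+1) = true) ?(_ : (s == s.+1) = false); last lia.
    by rewrite !exprS; split; field.
  rewrite (_ : (i.+1 == s.+1) = false); last lia.
  by rewrite !exprS; split; field; rewrite ?x0 ?y0.
- rewrite -h.
  by rewrite !exprS; split; field.
Qed.

(** This is the count of nonzero right kernel vectors at [k = i.+1], with [closed_form] in place of
    [rkcount]; the weight separates into the two sums of [closed_form_sums]. *)
Lemma closed_form_identity s i : (0 < s)%N ->
  \sum_(r < i.+1) closed_form s r (2 ^+ i.+1) * (2 ^+ (i.+1 - r) - 1) =
  (2 ^+ i.+1 - 1) * 4 ^+ i.
Proof.
move=> s0; have [S1 S2] := closed_form_sums s i (2 ^+ i.+1) s0.
have y0 : (2 : rat) ^+ i != 0 by rewrite expf_neq0.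
have x0 : (2 : rat) ^+ s != 0 by rewrite expf_neq0.
rewrite (eq_bigr (fun r : 'I_i.+1 => 2 ^+ i.+1 * (closed_form s r (2 ^+ i.+1) / 2 ^+ r)
                              - closed_form s r (2 ^+ i.+1))); last first.
  by move=> r _; rewrite expfB // mulrBr mulr1 mulrCA.
rewrite sumrB -mulr_sumr S1 S2 (_ : 4 = 2 ^+ 2) // -exprM mulnC exprM.
rewrite /closed_sum /closed_wsum.
have [h|h|->] := ltngtP i s; rewrite !exprS; field; by rewrite ?x0 ?y0.
Qed.

Lemma primsum_rat n k j :
  (primsum n k j)%:~R = (2 ^+ (n - 2 * j) - 1) * 2 ^+ (n + k - 2 - j) :> rat.
Proof. by rewrite /primsum -pmulrn natrM natrB ?expn_gt0 // !natrX. Qed.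

(** It shows that [closed_form] varies with [k] exactly as [rkcount_shift] prescribes, so for each
    [i] one value of [k] remains to be settled. *)
Lemma primsum_closed s i k : (0 < s)%N -> (i <= 2 * s)%N -> (i < k)%N ->
  (primsum (2 * s + 1) k (2 * s - i) - 3 * primsum (2 * s + 1) k (2 * s - i).+1
    + 2 * primsum (2 * s + 1) k (2 * s - i).+2)%:~R =
  closed_form s i (2 ^+ k) - closed_form s i 0.
Proof.
move=> s0 i2 ik; rewrite !(intrD, intrM, intrN, primsum_rat) /closed_form.
have [i0|i0] := eqVneq i 0%N.
  rewrite (_ : 2 * s + 1 - _ = 0)%N; last lia.
  rewrite (_ : 2 * s + 1 - 2 * _.+1 = 0)%N; last lia.
  rewrite (_ : 2 * s + 1 - 2 * _.+2 = 0)%N; last lia.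
  by rewrite expr0; ring.
have x0 : (2 : rat) ^+ s != 0 by rewrite expf_neq0.
have [h|h|h] := ltngtP i s.
(* Below [s] all three truncated exponents vanish, which is why these counts do not depend on
   [k]. *)
- rewrite (_ : 2 * s + 1 - _ = 0)%N; last lia.
  rewrite (_ : 2 * s + 1 - 2 * _.+1 = 0)%N; last lia.
  rewrite (_ : 2 * s + 1 - 2 * _.+2 = 0)%N; last lia.
  by rewrite expr0; ring.
- have [e|ne] := eqVneq i s.+1.
    have [t st] : exists t, s = t.+1 by exists s.-1; lia.
    have [l kl] : exists l, k = l.+1 by exists k.-1; lia.
    rewrite (_ : 2 * s + 1 - _ = 3)%N; last lia.
    rewrite (_ : 2 * s + 1 - 2 * _.+1 = 1)%N; last lia.
    rewrite (_ : 2 * s + 1 - 2 * _.+2 = 0)%N; last lia.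
    rewrite (_ : 2 * s + 1 + k - 2 - (2 * s - i) = s + k)%N; last lia.
    rewrite (_ : 2 * s + 1 + k - 2 - (2 * s - i).+1 = s + l)%N; last lia.
    by rewrite kl !exprD !exprS expr0; field.
  have [t it] : exists t, i = (s + t.+2)%N by exists (i - s - 2)%N; lia.
  have [l kl] : exists l, k = (l + s + t + 3)%N by exists (k - s - t - 3)%N; lia.
  rewrite (_ : 2 * s + 1 - _ = 2 * t + 5)%N; last lia.
  rewrite (_ : 2 * s + 1 - 2 * _.+1 = 2 * t + 3)%N; last lia.
  rewrite (_ : 2 * s + 1 - 2 * _.+2 = 2 * t + 1)%N; last lia.
  rewrite (_ : 2 * s + 1 + k - 2 - (2 * s - i) = l + s + t + s + t + 4)%N; last lia.
  rewrite (_ : 2 * s + 1 + k - 2 - (2 * s - i).+1 = l + s + t + s + t + 3)%N; last lia.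
  rewrite (_ : 2 * s + 1 + k - 2 - (2 * s - i).+2 = l + s + t + s + t + 2)%N; last lia.
  rewrite it kl mulnC !exprD !exprM !exprS expr0; field.
  by rewrite x0.
- rewrite h in ik *; have [l kl] : exists l, k = l.+1 by exists k.-1; lia.
  rewrite (_ : 2 * s + 1 - _ = 1)%N; last lia.
  rewrite (_ : 2 * s + 1 - 2 * _.+1 = 0)%N; last lia.
  rewrite (_ : 2 * s + 1 - 2 * _.+2 = 0)%N; last lia.
  rewrite (_ : 2 * s + 1 + k - 2 - (2 * s - s) = s + l)%N; last lia.
  by rewrite kl !exprD !exprS expr0; field.
Qed.

Lemma rkcount_closed s i k : (0 < s)%N -> (i <= 2 * s)%N -> (i < k)%N ->
  (rkcount (2 * s + 1) k i)%:R = closed_form s i (2 ^+ k) :> rat.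
Proof.
move=> s0; elim/ltn_ind: i k => i IH k i2 ik.
set n := (2 * s + 1)%N in IH *.
suff base : (rkcount n i.+1 i)%:R = closed_form s i (2 ^+ i.+1) :> rat.
  have n1 : (1 < n)%N by rewrite /n; lia.
  have hin : (i < n)%N by rewrite /n; lia.
  have := rkcount_shift n k i.+1 i n1 hin ik (ltnSn i).
  rewrite /= (_ : (n - i.+1) = 2 * s - i)%N; last by rewrite /n; lia.
  move/(congr1 (fun z : int => z%:~R : rat)); rewrite !intrB !(primsum_closed s) //.
  by rewrite -!pmulrn base => /eqP; rewrite subr_eq => /eqP ->; ring.
have T := sum_rkcount n i.+1 i.+1 isT (fun c => rank_leq_col _).
have W := sum_rkcount_kernel n i.+1 isT.
have {}T : \sum_(r < i.+2) (rkcount n i.+1 r)%:R = (2 ^ seqlen n i.+1)%N%:R :> rat.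
  by rewrite -T natr_sum.
have {}W : \sum_(r < i.+2) 2 ^+ (i.+1 - r) * (rkcount n i.+1 r)%:R =
    (2 ^ seqlen n i.+1)%N%:R + (2 ^+ i.+1 - 1) * 4 ^+ i :> rat.
  have := congr1 (fun z : nat => z%:R : rat) W; rewrite natr_sum natrD natrM natrB ?expn_gt0 //.
  rewrite !natrX exprM (_ : (2 : rat) ^+ 2 = 4) // => <-.
  by apply: eq_bigr => r _; rewrite natrM natrX.
have E : \sum_(r < i.+2) (2 ^+ (i.+1 - r) - 1) * (rkcount n i.+1 r)%:R =
    (2 ^+ i.+1 - 1) * 4 ^+ i :> rat.
  under eq_bigr do rewrite mulrBl mul1r.
  by rewrite sumrB W T addrC addKr.
have := closed_form_identity s i s0; rewrite -E.
(* The weight [2 ^ (i.+1 - r) - 1] is 0 at [r = i.+1] and 1 at [r = i]. With smaller ranks known by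
   induction, the equation determines the count at rank [i]. *)
rewrite big_ord_recr [in RHS]big_ord_recr [X in _ = X + _]big_ord_recr /=.
rewrite subnn expr0 subrr mul0r addr0 subSnn expr1.
rewrite (eq_bigr (fun r : 'I_i => (2 ^+ (i.+1 - r) - 1) * (rkcount n i.+1 r)%:R)).
  by move/addrI; rewrite (_ : 2 - 1 = 1 :> rat) // mulr1 mul1r => ->.
move=> r _; rewrite mulrC IH //; have := ltn_ord r; lia.
Qed.

(** Full rank is what the smaller ranks leave of all [2 ^ seqlen n k] sequences, where
    [seqlen n k = 2 * s + 2 * k - 1]. *)
Lemma rkcount_full s k : (0 < s)%N -> (2 * s + 1 < k)%N ->
  (rkcount (2 * s + 1) k (2 * s + 1))%:R =
  2 ^+ (2 * s + 2 * k) / 2 - closed_sum s (2 * s) (2 ^+ k) :> rat.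
Proof.
move=> s0 hk; set n := (2 * s + 1)%N in hk *.
have k0 : (0 < k)%N by lia.
have := sum_rkcount n k n k0 (fun c => rank_leq_row _).
move/(congr1 (fun z : nat => z%:R : rat)); rewrite natr_sum natrX big_ord_recr /=.
have [<- _] := closed_form_sums s (2 * s) (2 ^+ k) s0.
rewrite [in X in X -> _]/n addn1 (eq_bigr (fun r : 'I_(2 * s).+1 => closed_form s r (2 ^+ k))).
  rewrite -[(2 * s).+1]addn1 -/n => h.
  rewrite (_ : (2 * s + 2 * k) = (seqlen n k).+1)%N; last by rewrite /seqlen /n; lia.
  by rewrite exprS -h; field.
move=> r _; have := rkcount_closed s r k s0; rewrite addn1; have := ltn_ord r => hr.
by apply; lia.
Qed.

(** * Integer exponents and the six cases *)

(** Exponents such as [3 * I - 4] can be negative; quotients of natural powers bring them within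
    reach of [field]. *)
Lemma pow2_frac (a b : nat) : (2 : rat) ^ (a%:Z - b%:Z) = 2 ^+ a / 2 ^+ b.
Proof. by rewrite expfzDr // -invr_expz. Qed.

Theorem theorem2p11 (s k i : nat) (hs : (1 <= s)%N) :
  let G : rat := (Gamma s k i)%:R in
  let pow2 (e : int) : rat := 2 ^ e in
  let S : int := s%:Z in
  let K : int := k%:Z in
  let I : int := i%:Z in
  (i = 0%N -> (1 <= k)%N -> G = 1) /\
  ((1 <= i <= s - 1)%N -> (i < k)%N ->
     G = 21 * pow2 (3 * I - 4) - 3 * pow2 (2 * I - 3)) /\
  (i = s -> (s < k)%N ->
     G = pow2 (K + S - 1) + 21 * pow2 (3 * S - 4) - 11 * pow2 (2 * S - 3)) /\
  (i = (s + 1)%N -> (s + 1 < k)%N ->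
     G = 11 * pow2 (K + S - 1) + 21 * pow2 (3 * S - 1) - 53 * pow2 (2 * S - 1)) /\
  ((s + 2 <= i <= 2 * s)%N -> (i < k)%N ->
     G = 21 * (pow2 (K - 2 * S + 3 * I - 5) + pow2 (3 * I - 4)
               - 5 * pow2 (4 * I - 2 * S - 6))) /\
  (i = (2 * s + 1)%N -> (2 * s + 1 < k)%N ->
     G = pow2 (2 * K + 2 * S - 1) - 3 * pow2 (K + 4 * S - 2) + pow2 (6 * S - 2)).
Proof.
move=> G pow2 S K I.
have x0 : (2 : rat) ^+ s != 0 by rewrite expf_neq0.
have P e (a b : nat) : e = a%:Z - b%:Z -> pow2 e = 2 ^+ a / 2 ^+ b.
  by move=> ->; apply: pow2_frac.
have GE : (i <= 2 * s)%N -> (i < k)%N -> G = closed_form s i (2 ^+ k).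
  by move=> i2 ik; rewrite /G Gamma_rkcount ?rkcount_closed //; lia.
split; [|split; [|split; [|split; [|split]]]].
- by move=> i0 k1; rewrite GE i0.
- move=> hi ik; rewrite GE //; last lia.
  rewrite (P _ (3 * i) 4)%N; last by rewrite /S /K /I; lia.
  rewrite (P _ (2 * i) 3)%N; last by rewrite /S /K /I; lia.
  rewrite /closed_form ifF; last lia.
  rewrite ifT; last lia.
  by rewrite !(mulnC _ i) !exprM; field.
- move=> hi ik; rewrite GE //; try lia.
  rewrite (P _ (k + s) 1)%N; last by rewrite /S /K /I; lia.
  rewrite (P _ (3 * s) 4)%N; last by rewrite /S /K /I; lia.
  rewrite (P _ (2 * s) 3)%N; last by rewrite /S /K /I; lia.
  rewrite /closed_form hi ltnn eqxx (_ : (s == 0%N) = false); last lia.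
  by rewrite !(mulnC _ s) exprD !exprM; field.
- move=> hi ik; rewrite GE //; try lia.
  rewrite (P _ (k + s) 1)%N; last by rewrite /S /K /I; lia.
  rewrite (P _ (3 * s) 1)%N; last by rewrite /S /K /I; lia.
  rewrite (P _ (2 * s) 1)%N; last by rewrite /S /K /I; lia.
  rewrite /closed_form hi addn1 eqxx (_ : (s.+1 < s)%N = false); last lia.
  rewrite (_ : (s.+1 == s) = false); last lia.
  rewrite (_ : (s.+1 == 0%N) = false); last lia.
  by rewrite !(mulnC _ s) exprD !exprM; field.
- move=> hi ik; rewrite GE //; try lia.
  rewrite (P _ (k + 3 * i) (2 * s + 5))%N; last by rewrite /S /K /I; lia.
  rewrite (P _ (3 * i) 4)%N; last by rewrite /S /K /I; lia.
  rewrite (P _ (4 * i) (2 * s + 6))%N; last by rewrite /S /K /I; lia.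
  rewrite /closed_form; do 4 (rewrite ifF; last lia).
  by rewrite !(mulnC _ s) !(mulnC _ i) !exprD !exprM; field.
- move=> hi ik; rewrite /G hi Gamma_rkcount ?rkcount_full //; try lia.
  rewrite (P _ (2 * k + 2 * s) 1)%N; last by rewrite /S /K /I; lia.
  rewrite (P _ (k + 4 * s) 2)%N; last by rewrite /S /K /I; lia.
  rewrite (P _ (6 * s) 2)%N; last by rewrite /S /K /I; lia.
  rewrite /closed_sum (_ : (2 * s < s)%N = false); last lia.
  rewrite (_ : (2 * s == s)%N = false); last lia.
  by rewrite !(mulnC _ s) !(mulnC _ k) !exprD !exprM; field.
Qed.
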